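(* Let $\mathscr{A}=\{1,\dots,k\}$ with a partition $\mathscr{A}=\mathscr{A}_{\mathrm{sing}}\sqcup\mathscr{A}_{\mathrm{inv}}$ into two nonempty sets, and let $\mu$ be either a Bernoulli measure $p^{\mathbb{Z}}$ (with $p_i>0$ for all $i$) or a Markov measure determined by a primitive left stochastic matrix $P$ and its stationary vector $q$. Then for Lebesgue almost every $\underline{A}\in\mathcal{M}$ we have $L_1(\underline{A})>-\infty$, and for every $\varepsilon>0$ there are constants $C<\infty$ and $c_0(\varepsilon)>0$ such that for all $n\ge 1$ $$\mu\Big\{\omega\in X:\ \Big|\tfrac1n\log\|A^n(\omega)\|-L_1(\underline{A})\Big|>\varepsilon\Big\}\le C\,e^{-c_0(\varepsilon)\,n^{1/3}}.$$
   Context: $X=\mathscr{A}^{\mathbb{Z}}$ with the left shift $\sigma(\omega)_n=\omega_{n+1}$. Bernoulli case: $\mu=p^{\mathbb{Z}}$ for a probability vector $p=(p_1,\dots,p_k)$ with all $p_i>0$. Markov case: $P=(p_{ij})$ is a left stochastic matrix ($p_{ij}\ge0$ is the probability of transition from $j$ to $i$, $\sum_i p_{ij}=1$), primitive (some power has all entries positive), $q$ its unique stationary probability vector $Pq=q$, and $\mu([k;i_0,\dots,i_n])=q_{i_0}p_{i_1i_0}\cdots p_{i_ni_{n-1}}$ on cylinders $[k;i_0,\dots,i_n]=\{\omega:\omega_{k+l}=i_l,\ 0\le l\le n\}$. A tuple $\underline{A}=(A_1,\dots,A_k)\in\mathrm{Mat}_2(\mathbb{R})^k$ defines the locally constant cocycle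 with fiber iterates $A^n(\omega)=A_{\omega_n}\cdots A_{\omega_1}$, and $L_1(\underline{A})=\lim_n\frac1n\log\|A^n(\omega)\|$ ($\mu$-a.e., constant). $\mathcal{M}=\{\underline{A}\in\mathrm{Mat}_2(\mathbb{R})^k:\ \mathrm{rank}A_i=1\ \forall i\in\mathscr{A}_{\mathrm{sing}},\ \det A_j>0\ \forall j\in\mathscr{A}_{\mathrm{inv}}\}$, an analytic manifold equipped with its Lebesgue measure class. *)

(* Defs.v *)
From HB Require Import structures.
From mathcomp Require Import all_boot all_order all_algebra.
From mathcomp Require Import all_classical all_reals all_analysis.
Set Implicit Arguments. Unset Strict Implicit. Unset Printing Implicit Defensive.
Import Order.TTheory GRing.Theory Num.Theory.
Import numFieldNormedType.Exports.
Local Open Scope classical_set_scope.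
Local Open Scope ring_scope.

(* Alphabet: 'I_k.+1 = {0,...,k} (the paper's {1,...,k+1}); the
   sequence space X = Z -> alphabet. *)
HB.instance Definition _ (n : nat) := isPointed.Build 'I_n.+1 ord0.
Notation seqsp k := (int -> 'I_k.+1).

Definition cylinder (k : nat) (m : int) (n : nat) (w : 'I_n.+1 -> 'I_k.+1)
  : set (seqsp k) := [set om | forall l : 'I_n.+1, om (m + (l : nat)%:Z) = w l].

Definition cylinders (k : nat) : set (set (seqsp k)) :=
  [set C | exists m n w, C = @cylinder k m n w].

Definition X (k : nat) := g_sigma_algebraType (@cylinders k).

Definition bernoulli_measure (R : realType) (k : nat)
    (mu : probability (X k) R) : Prop :=
  exists p : 'I_k.+1 -> R,
    (forall i, 0 < p i) /\ \sum_i p i = 1 /\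
    forall m n w, mu (@cylinder k m n w) = (\prod_(l < n.+1) p (w l))%:E.

(* matrix power by iteration (works for any size) *)
Definition mxpow (R : realType) (k : nat) (P : 'M[R]_k) (m : nat) : 'M[R]_k :=
  iter m (mulmx P) 1%:M.

(* Markov measure: P left stochastic (P i j = prob. of transition j -> i),
   primitive, q its stationary probability vector. *)
Definition markov_measure (R : realType) (k : nat)
    (mu : probability (X k) R) : Prop :=
  exists (P : 'M[R]_k.+1) (q : 'I_k.+1 -> R),
    (forall i j, 0 <= P i j) /\ (forall j, \sum_i P i j = 1) /\
    (exists m, forall i j, 0 < mxpow P m i j) /\
    (forall i, 0 <= q i) /\ \sum_i q i = 1 /\
    (forall i, \sum_j P i j * q j = q i) /\
    forall m n w, mu (@cylinder k m n w) =
      (q (w ord0) * \prod_(l < n) P (w (lift ord0 l)) (w (widen_ord (leqnSn n) l)))%:E.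

Fixpoint cocycle (R : realType) (k : nat) (A : 'I_k.+1 -> 'M[R]_2)
    (om : seqsp k) (n : nat) : 'M[R]_2 :=
  match n with
  | 0 => 1%:M
  | n'.+1 => A (om (n'.+1 : nat)%:Z) *m cocycle A om n'
  end.

Definition vnorm (R : realType) (v : 'cV[R]_2) : R :=
  Num.sqrt (\sum_i v i 0 ^+ 2).

Definition opnorm (R : realType) (M : 'M[R]_2) : R :=
  sup [set vnorm (M *m v) | v in [set v : 'cV[R]_2 | vnorm v = 1]].

Definition elog (R : realType) (x : R) : \bar R :=
  if x == 0 then -oo%E else (ln x)%:E.

Definition lyap_n (R : realType) (k : nat) (A : 'I_k.+1 -> 'M[R]_2)
    (om : seqsp k) (n : nat) : \bar R :=
  ((n%:R)^-1)%:E * elog (opnorm (cocycle A om n)).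

Definition is_L1 (R : realType) (k : nat) (mu : probability (X k) R)
    (A : 'I_k.+1 -> 'M[R]_2) (L : \bar R) : Prop :=
  {ae mu, forall om : X k, lyap_n A om n @[n --> \oo] --> L}.

Definition inM (R : realType) (k : nat) (sing : {set 'I_k.+1})
    (A : 'I_k.+1 -> 'M[R]_2) : Prop :=
  (forall i, i \in sing -> \rank (A i) = 1%N) /\
  (forall j, j \notin sing -> 0 < \det (A j)).

Definition lebesgue_null (R : realType) (D : finType) (N : set (D -> R)) : Prop :=
  forall eps : R, 0 < eps -> exists a b : nat -> D -> R,
    (forall n j, a n j <= b n j) /\
    N `<=` \bigcup_n [set x | forall j, a n j <= x j <= b n j] /\
    forall m, \sum_(n < m) \prod_(j : D) (b n j - a n j) <= eps.

(* Parametrization of (a submersion onto) M by an open subset of R^{4(k+1)}: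
   for i singular, A_i = u v^T with u = (x(i,0),x(i,1)), v = (x(i,2),x(i,3));
   for i invertible, A_i = [[x(i,0), x(i,1)],[x(i,2), x(i,3)]]. *)
Definition param (R : realType) (k : nat) (sing : {set 'I_k.+1})
    (x : 'I_k.+1 * 'I_4 -> R) : 'I_k.+1 -> 'M[R]_2 :=
  fun i => if i \in sing then
      \matrix_(r < 2, c < 2) (x (i, inord r) * x (i, inord (2 + c)))
    else \matrix_(r < 2, c < 2) x (i, inord (2 * r + c)).

Definition ae_M (R : realType) (k : nat) (sing : {set 'I_k.+1})
    (Q : ('I_k.+1 -> 'M[R]_2) -> Prop) : Prop :=
  lebesgue_null [set x : 'I_k.+1 * 'I_4 -> R |
     inM sing (param sing x) /\ ~ Q (param sing x)].

(* Main.v *)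
(* Write A_s = u_s v_s for the singular letters s. By a Borel-Cantelli argument in
   parameter space, for almost every A there is tau > 0 such that
   |v_{s'} A_w u_s| >= tau^(1+|w|) for all singular s, s' and all words w without
   singular letters: this pairing is affine in v_{s'} with slope at least
   exponentially large in -|w|, and there are only exponentially many words of each
   length. A product containing a singular letter factors through these pairings,
   so S(w) = log|A_w| is subadditive and cutting a word at a point costs at most a
   multiple of the length of the singular-free gap around the cut. Charging the two
   end gaps of w gives a superadditive T <= S with |S|, |T| = O(|w|). The gaps have
   mean o(n) and the chain forgets its initial state, so S and T have
   the same growth rate L; the Chernoff bound over blocks of fixed length, applied
   to S and to -T, yields deviations of probability at most C exp(- t n), which is
   stronger than the claim, and the almost sure convergence follows from
   Borel-Cantelli. *)
Require Import Defs.
From HB Require Import structures.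
From mathcomp Require Import all_boot all_order all_algebra.
From mathcomp Require Import all_classical all_reals all_analysis.
From mathcomp Require Import ring lra.
Set Implicit Arguments. Unset Strict Implicit. Unset Printing Implicit Defensive.
Import Order.TTheory GRing.Theory Num.Theory.
Import numFieldNormedType.Exports.
Local Open Scope classical_set_scope.
Local Open Scope ring_scope.

(** * Expectations and exponential moments along a Markov chain *)

Section MarkovExpectation.
Variables (R : realType) (k : nat) (P : 'M[R]_k.+1).
Hypothesis P_ge0 : forall i j, 0 <= P i j.
Hypothesis P_sum1 : forall j, \sum_i P i j = 1.
Implicit Types (i j : 'I_k.+1) (w : seq 'I_k.+1) (F G H : seq 'I_k.+1 -> R).

(* Expectation of G [:: w_1; ...; w_n] for the chain conditioned on w_0 = j; the
   letter w_0 itself is not passed to G. *)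
Fixpoint Ex (n : nat) j G : R :=
  if n is n'.+1 then \sum_i P i j * Ex n' i (fun w => G (i :: w)) else G [::].

Lemma le_Ex n j G H :
  (forall w, size w = n -> G w <= H w) -> Ex n j G <= Ex n j H.
Proof.
elim: n j G H => [|n IH] j G H GH /=; first exact: GH.
apply: ler_sum => i _; apply: ler_wpM2l => //.
by apply: IH => w sw; apply: GH; rewrite /= sw.
Qed.

Lemma eq_Ex n j G H :
  (forall w, size w = n -> G w = H w) -> Ex n j G = Ex n j H.
Proof.
elim: n j G H => [|n IH] j G H GH /=; first exact: GH.
by apply: eq_bigr => i _; congr (_ * _); apply: IH => w sw; apply: GH; rewrite /= sw.
Qed.

Lemma Ex_cst n j c : Ex n j (fun=> c) = c.
Proof.
elim: n j => //= n IH j; under eq_bigr do rewrite IH.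
by rewrite -mulr_suml P_sum1 mul1r.
Qed.

Lemma ExD n j G H : Ex n j (fun w => G w + H w) = Ex n j G + Ex n j H.
Proof.
elim: n j G H => //= n IH j G H; rewrite -big_split /=.
by apply: eq_bigr => i _; rewrite IH mulrDr.
Qed.

Lemma ExZ n j a G : Ex n j (fun w => a * G w) = a * Ex n j G.
Proof.
elim: n j G => //= n IH j G; rewrite mulr_sumr.
by apply: eq_bigr => i _; rewrite IH mulrCA.
Qed.

Lemma ExN n j G : Ex n j (fun w => - G w) = - Ex n j G.
Proof.
by rewrite -mulN1r -ExZ; apply: eq_Ex => w _; rewrite mulN1r.
Qed.

Lemma Ex_cat m n j G :
  Ex (m + n) j G = Ex m j (fun w => Ex n (last j w) (fun w' => G (w ++ w'))).
Proof.
elim: m j G => //= m IH j G; apply: eq_bigr => i _; congr (_ * _).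
by rewrite IH.
Qed.

Lemma Ex_le_bound n j G c : (forall w, size w = n -> G w <= c) -> Ex n j G <= c.
Proof. by move=> Gc; rewrite -[leRHS](Ex_cst n j); apply: le_Ex. Qed.

Lemma Ex_ge_bound n j G c : (forall w, size w = n -> c <= G w) -> c <= Ex n j G.
Proof. by move=> Gc; rewrite -[leLHS](Ex_cst n j); apply: le_Ex. Qed.

Definition subadd F := forall w w', F (w ++ w') <= F w + F w'.

(** From exp(-x/2) >= 1 - x/2 follows exp(x) (1 - x/2)^2 <= 1, while (1 + x + x^2) (1 - x/2)^2
    exceeds 1 by x^2/4 times 1 - 3x + x^2, nonnegative for x <= 1/4. *)
Lemma expR_le_quadratic (x : R) : `|x| <= 1 / 4 -> expR x <= 1 + x + x ^+ 2.
Proof.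
rewrite ler_norml => /andP[x1 x2].
have h : 0 < 1 - x / 2 by lra.
have e2 : expR x * expR (- (x / 2)) ^+ 2 = 1.
  by rewrite expr2 -!expRD -[RHS]expR0; congr expR; field.
have le : (1 - x / 2) ^+ 2 <= expR (- (x / 2)) ^+ 2.
  rewrite lerXn2r ?nnegrE ?expR_ge0 ?(ltW h)//.
  by have := expR_ge1Dx (- (x / 2)); lra.
have {}le : expR x * (1 - x / 2) ^+ 2 <= 1 by rewrite -[leRHS]e2 ler_pM2l ?expR_gt0.
rewrite -(ler_pM2r (exprn_gt0 2 h)); apply: le_trans le _.
have -> : (1 + x + x ^+ 2) * (1 - x / 2) ^+ 2
  = 1 + x ^+ 2 / 4 * ((1 - 3 * x) + x ^+ 2) by field.
rewrite lerDl mulr_ge0 ?divr_ge0 ?sqr_ge0//.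
by rewrite addr_ge0 ?sqr_ge0//; lra.
Qed.

(** The quadratic term of the exponential is at most [t ^+ 2 * B ^+ 2 <= t * e], so it only shifts
    the mean [g] by [e]. *)
Lemma exp_moment_block F m B g e t j : 0 <= t -> t * B <= 1 / 4 -> t * B ^+ 2 <= e ->
  (forall w, size w = m -> `|F w| <= B) -> Ex m j F <= g ->
  Ex m j (fun w => expR (t * F w)) <= expR (t * (g + e)).
Proof.
move=> t0 tB1 tB2 FB Fg; apply: le_trans (expR_ge1Dx _).
have -> : 1 + t * (g + e) = 1 + t * g + t * e by ring.
apply: (@le_trans _ _ (Ex m j (fun w => 1 + t * F w + t * e))); last first.
  rewrite !ExD !Ex_cst ExZ; have := ler_wpM2l t0 Fg; lra.
apply: le_Ex => w /FB FB'.
have tF : `|t * F w| <= 1 / 4 by rewrite normrM (ger0_norm t0) (le_trans _ tB1)// ler_wpM2l.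
apply: le_trans (expR_le_quadratic tF) _; rewrite lerD2l.
have : F w ^+ 2 <= B ^+ 2 by rewrite -real_normK ?num_real// lerXn2r ?nnegrE// (le_trans _ FB').
move=> /(ler_wpM2l (mulr_ge0 t0 t0)).
rewrite exprMn -expr2 => /le_trans; apply.
by rewrite expr2 -mulrA ler_wpM2l.
Qed.

(** Subadditivity makes exp(t F) submultiplicative. The block bound is uniform in the initial state,
    so it applies conditionally on the preceding letters. *)
Lemma exp_moment_blocks F m B a t N j : 0 <= t -> subadd F -> F [::] <= B ->
  (forall i, Ex m i (fun w => expR (t * F w)) <= expR (t * a)) ->
  Ex (N * m) j (fun w => expR (t * F w)) <= expR (t * (N%:R * a + B)).
Proof.
move=> t0 sF FB Fm; elim: N j => [|N IH] j.
  by rewrite mul0n mul0r add0r /= ler_expR ler_wpM2l.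
rewrite mulSn Ex_cat.
apply: (@le_trans _ _
  (Ex m j (fun w => expR (t * (N%:R * a + B)) * expR (t * F w)))).
  apply: le_Ex => w _; apply: (@le_trans _ _
    (Ex (N * m) (last j w) (fun w' => expR (t * F w) * expR (t * F w')))).
    by apply: le_Ex => w' _; rewrite -expRD ler_expR -mulrDr ler_wpM2l.
  by rewrite ExZ mulrC ler_wpM2r ?expR_ge0.
rewrite ExZ; apply: (@le_trans _ _ (expR (t * (N%:R * a + B)) * expR (t * a))).
  by rewrite ler_wpM2l ?expR_ge0.
by rewrite -expRD ler_expR -natr1; lra.
Qed.

(* Cramer-Chernoff: by subadditivity the exponential moment of F over n letters
   is at most the product of the moments over the n %/ m blocks of length m. *)
Lemma upper_deviation F (K : R) m (g e b : R) : subadd F ->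
  (forall w, `|F w| <= K * (size w).+1%:R) ->
  (0 < m)%N -> (forall j, Ex m j F <= g * m%:R) -> 0 < e ->
  exists C t : R, [/\ 0 < C, 0 < t & forall n j,
    Ex n j (fun w => (n%:R * (g + e) - b < F w)%R%:R) <= C * expR (- t * n%:R)].
Proof.
move=> sF FK m0 Fm e0.
have K0 : 0 <= K by have := FK [::]; rewrite mulr1; apply: le_trans.
pose B := K * m.+1%:R.
have B0 : 0 <= B by rewrite mulr_ge0.
have mR : (0 : R) < m%:R by rewrite ltr0n.
pose e' := e * m%:R / 2.
have e'0 : 0 < e' by rewrite divr_gt0// mulr_gt0.
(* The two bounds give the smallness hypotheses of [exp_moment_block] with tolerance [e'], half of
   the allowance of a block; the other half yields the decay. *)
pose t := Num.min (4 * B + 1)^-1 (e' / (B ^+ 2 + 1)).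
have t0 : 0 < t.
  rewrite lt_min invr_gt0 divr_gt0// ?andbT; first by lra.
  by rewrite ltr_wpDl// sqr_ge0.
have tB : t * B <= 1 / 4.
  apply: (@le_trans _ _ ((4 * B + 1)^-1 * B)); first by rewrite ler_wpM2r// ge_min lexx.
  by rewrite mulrC ler_pdivrMr; lra.
have tB2 : t * B ^+ 2 <= e'.
  have B21 : 0 < B ^+ 2 + 1 by rewrite ltr_wpDl// sqr_ge0.
  apply: (@le_trans _ _ (e' / (B ^+ 2 + 1) * B ^+ 2)).
    by rewrite ler_wpM2r ?sqr_ge0// ge_min lexx orbT.
  rewrite mulrAC ler_pdivrMr// ler_pM2l//; lra.
have FB w : size w = m -> `|F w| <= B by move=> sw; rewrite /B -sw.
pose a := g * m%:R + e'.
have Em j : Ex m j (fun w => expR (t * F w)) <= expR (t * a).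
  exact: (exp_moment_block (ltW t0) tB tB2 FB (Fm j)).
(* [D] collects what does not grow with [n]: the incomplete block, the value on the empty word, the
   slack [b], and the rounding of [n] to a multiple of [m]. *)
pose D := t * (B + B + b + `|a|).
exists (expR D), (t * (e / 2)); split.
- exact: expR_gt0.
- by rewrite mulr_gt0// divr_gt0.
move=> n j.
apply: (@le_trans _ _ (Ex n j (fun w =>
   expR (- (t * (n%:R * (g + e) - b))) * expR (t * F w)))).
  apply: le_Ex => w _; rewrite -expRD.
  case: ltP => [lt|_]; last exact: expR_ge0.
  rewrite -[leLHS]expR0 ler_expR -mulrN -mulrDr mulr_ge0 ?(ltW t0)//; lra.
rewrite ExZ.
have En : Ex n j (fun w => expR (t * F w)) <=
          expR (t * B) * expR (t * ((n %/ m)%:R * a + B)).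
  rewrite {1}(divn_eq n m) Ex_cat.
  apply: (@le_trans _ _ (Ex (n %/ m * m) j (fun w => expR (t * B) * expR (t * F w)))).
    apply: le_Ex => w _; apply: Ex_le_bound => w' sw'.
    rewrite -expRD ler_expR -mulrDr ler_wpM2l ?(ltW t0)//.
    apply: le_trans (sF _ _) _; rewrite addrC lerD2r.
    apply: le_trans (ler_norm _) _; apply: le_trans (FK _) _.
    by rewrite ler_wpM2l// ler_nat sw' ltnS ltnW// ltn_mod.
  rewrite ExZ ler_wpM2l ?expR_ge0//; apply: exp_moment_blocks => //; first exact: ltW.
  apply: le_trans (ler_norm _) _; apply: le_trans (FK _) _.
  by rewrite ler_wpM2l// ler_nat.
apply: le_trans (ler_wpM2l (expR_ge0 _) En) _.
rewrite -!expRD ler_expR /D.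
have -> : t * (B + B + b + `|a|) + - (t * (e / 2)) * n%:R =
  t * (B + B + b + `|a| - e / 2 * n%:R) by ring.
have -> : - (t * (n%:R * (g + e) - b)) + (t * B + t * ((n %/ m)%:R * a + B)) =
  t * (B + B + b + ((n %/ m)%:R * a - n%:R * (g + e))) by ring.
rewrite ler_wpM2l ?(ltW t0)// -[leRHS]addrA lerD2l.
have nE : n%:R = (n %/ m)%:R * m%:R + (n %% m)%:R :> R by rewrite -natrM -natrD -divn_eq.
have am : a = (g + e / 2) * m%:R by rewrite /a /e'; field.
have rm : (n %% m)%:R <= m%:R :> R by rewrite ler_nat ltnW// ltn_mod.
have : - (g + e / 2) * (n %% m)%:R <= `|a|.
  apply: le_trans (ler_norm _) _; rewrite normrM normrN am normrM ler_wpM2l//.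
  by rewrite !ger0_norm.
rewrite am; set q : R := (n %/ m)%:R; set r : R := (n %% m)%:R.
move=> h; rewrite nE -/q -/r; lra.
Qed.

End MarkovExpectation.

(** * Mixing and the common growth rate *)

Lemma fin_pos_lower_bound (R : realType) (T : finType) (f : T -> R) :
  (forall x, 0 < f x) -> exists a, [/\ 0 < a, a <= 1 & forall x, a <= f x].
Proof.
move=> f0; exists (\big[Num.min/1]_x f x); split.
- by apply/bigmin_gtP; split => // x _; exact: f0.
- exact: bigmin_le_id.
- by move=> x; apply: bigmin_le_cond.
Qed.

Section Mixing.
Variables (R : realType) (k : nat) (P : 'M[R]_k.+1).
Hypothesis P_ge0 : forall i j, 0 <= P i j.
Hypothesis P_sum1 : forall j, \sum_i P i j = 1.
Variable m0 : nat.
Hypothesis P_prim : forall i j, 0 < mxpow P m0 i j.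
Local Notation Ex := (Ex P).
Implicit Types (i j : 'I_k.+1) (w : seq 'I_k.+1) (F G S T : seq 'I_k.+1 -> R).

Lemma Ex_last m j (g : 'I_k.+1 -> R) :
  Ex m j (fun w => g (last j w)) = \sum_i mxpow P m i j * g i.
Proof.
elim: m g => [|m IH] g.
  rewrite /= (bigD1 j)//= big1 ?addr0; first by rewrite mxE eqxx mul1r.
  by move=> i ij; rewrite mxE (negPf ij) mul0r.
rewrite -addn1 Ex_cat.
under eq_Ex => w _ do (under eq_Ex => w' _ do rewrite last_cat).
rewrite (IH (fun l => Ex 1 l (fun w' => g (last l w')))) addn1 /=.
under [RHS]eq_bigr => i _ do rewrite mxE mulr_suml.
rewrite exchange_big /=; apply: eq_bigr => l _; rewrite mulr_sumr.
by apply: eq_bigr => i _; rewrite mulrCA mulrA.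
Qed.

Lemma mxpow_sum1 m j : \sum_i mxpow P m i j = 1.
Proof.
have := Ex_last m j (fun=> 1); rewrite Ex_cst// => ->.
by apply: eq_bigr => i _; rewrite mulr1.
Qed.

(* Dobrushin contraction: weights bounded below by a pull every average of g
   towards the fixed value g ord0 by the factor a. *)
Lemma mixing_contraction a t (g : 'I_k.+1 -> R) (l u : R) :
  (forall i j, a <= mxpow P m0 i j) -> a <= 1 -> (forall i, l <= g i <= u) ->
  exists l' u', u' - l' <= (1 - a) ^+ t * (u - l) /\
   forall j, l' <= Ex (t * m0) j (fun w => g (last j w)) <= u'.
Proof.
move=> aP a1; elim: t g l u => [|t IH] g l u gb.
  by exists l, u; split; [rewrite expr0 mul1r | move=> j; rewrite mul0n; exact: gb].
pose h j := Ex m0 j (fun w => g (last j w)).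
have hb j : l + a * (g ord0 - l) <= h j <= u - a * (u - g ord0).
  rewrite /h Ex_last.
  have e c : \sum_i mxpow P m0 i j * g i = c + \sum_i mxpow P m0 i j * (g i - c).
    rewrite -[X in X + _]mul1r -(mxpow_sum1 m0 j) mulr_suml -big_split /=.
    by apply: eq_bigr => i _; ring.
  have m_ge0 i : 0 <= mxpow P m0 i j by exact: ltW.
  apply/andP; split.
    rewrite (e l) lerD2l (bigD1 ord0)//= ler_wpDr//.
      by apply: sumr_ge0 => i _; rewrite mulr_ge0// subr_ge0; have /andP[] := gb i.
    by rewrite ler_wpM2r// subr_ge0; have /andP[] := gb ord0.
  rewrite (e u) lerD2l (bigD1 ord0)//= -[leRHS]addr0 lerD//.
    by rewrite -mulrN opprB ler_wnM2r// subr_le0; have /andP[] := gb ord0.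
  by apply: sumr_le0 => i _; rewrite mulr_ge0_le0// subr_le0; have /andP[] := gb i.
have [l' [u' [d b]]] := IH h _ _ hb.
exists l', u'; split.
  apply: le_trans d _; rewrite exprSr -mulrA ler_wpM2l ?exprn_ge0 ?subr_ge0//.
  by lra.
move=> j; rewrite mulSn addnC Ex_cat.
under eq_Ex => w _ do (under eq_Ex => w' _ do rewrite last_cat).
exact: b.
Qed.

(** The horizon [r] depends on [e] but not on [g]: repeated contraction shrinks the range [-B, B],
    of length 2B, by a factor below e/2. *)
Lemma mixing (e : R) : 0 < e -> exists r, forall (g : 'I_k.+1 -> R) (B : R),
  (forall i, `|g i| <= B) -> forall j j',
  Ex r j (fun w => g (last j w)) <= Ex r j' (fun w => g (last j' w)) + e * B.
Proof.
move=> e0.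
have [a [a0 a1 aP]] := @fin_pos_lower_bound R _
  (fun ij : 'I_k.+1 * 'I_k.+1 => mxpow P m0 ij.1 ij.2) (fun ij => P_prim _ _).
have : (fun t => (1 - a) ^+ t : R) @ \oo --> 0.
  by have := @cvg_expr R (1 - a); apply; rewrite ltr_norml; lra.
move=> /cvgrPdist_lt /(_ (e / 2)); rewrite divr_gt0// => /(_ isT)[t _ /(_ t)/= /(_ (leqnn t))].
rewrite sub0r normrN => /ltW te; exists (t * m0)%N => g B gB j j'.
have B0 : 0 <= B by rewrite (le_trans _ (gB ord0)).
have [||i|l [u [lu b]]] := @mixing_contraction a t g (- B) B.
- by move=> i i'; exact: (aP (i, i')).
- exact: a1.
- by rewrite -ler_norml.
have /andP[_ h1] := b j; have /andP[h2 _] := b j'.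
have : (1 - a) ^+ t * (B - - B) <= e / 2 * (B - - B).
  by rewrite ler_wpM2r ?(le_trans (ler_norm _) te)//; lra.
lra.
Qed.

Variable sing : {pred 'I_k.+1}.
Hypothesis sing_ne0 : exists i, i \in sing.
Hypothesis m0_gt0 : (0 < m0)%N.

Local Notation none := (fun w => (~~ has (mem sing) w)%:R : R).

(** Whatever the state before it, a block of [m0] letters ends in a fixed singular [s] with
    probability at least [a], so [t] blocks avoid all singular letters with probability at most (1 -
    a)^t. *)
Lemma Ex_none_small (e : R) : 0 < e ->
  exists r, forall j, Ex r j none <= e.
Proof.
move=> e0; have [s ss] := sing_ne0.
have [a [a0 a1 aP]] := @fin_pos_lower_bound R _
  (fun ij : 'I_k.+1 * 'I_k.+1 => mxpow P m0 ij.1 ij.2) (fun ij => P_prim _ _).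
have : (fun t => (1 - a) ^+ t : R) @ \oo --> 0.
  by have := @cvg_expr R (1 - a); apply; rewrite ltr_norml; lra.
move=> /cvgrPdist_lt /(_ e e0)[t _ /(_ t)/= /(_ (leqnn t))].
rewrite sub0r normrN => /ltW te; exists (t * m0)%N => j.
apply: (@le_trans _ _ ((1 - a) ^+ t)); last exact: le_trans (ler_norm _) te.
elim: t {te} j => [|t IH] j.
  by apply: (Ex_le_bound P_ge0 P_sum1) => w _; rewrite expr0; case: has.
rewrite mulSn Ex_cat.
apply: (@le_trans _ _ (Ex m0 j (fun w => (1 - a) ^+ t * none w))).
  apply: (le_Ex P_ge0) => w _; rewrite mulrC.
  apply: (@le_trans _ _ (Ex (t * m0) (last j w) (fun w' => none w * none w'))).
    apply: (le_Ex P_ge0) => w' _; rewrite has_cat negb_or.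
    by case: has; case: has; rewrite ?mulr1 ?mul0r ?mulr0.
  by rewrite ExZ; rewrite ler_wpM2l.
rewrite ExZ exprSr ler_wpM2l ?exprn_ge0 ?subr_ge0//.
pose g i : R := 1 - (i == s)%:R.
apply: (@le_trans _ _ (Ex m0 j (fun w => g (last j w)))).
  apply: (le_Ex P_ge0) => w sw; rewrite /g.
  have [ws|//=] := eqVneq (last j w) s; last by rewrite subr0; case: has.
  suff -> : has (mem sing) w by rewrite subrr.
  apply/hasP; exists s => //.
  (* [m0_gt0] excludes the empty block, where [last j w] is [j] and not a letter of [w]. *)
  by case: w sw ws m0_gt0 => [<-|i w _ /= <-] // _; rewrite mem_last.
rewrite Ex_last; under eq_bigr do rewrite mulrBr mulr1.
rewrite big_split /= mxpow_sum1 lerD2l sumrN lerN2 (bigD1 s)//= eqxx mulr1.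
rewrite big1 ?addr0; first exact: (aP (s, j)).
by move=> i /negPf ->; rewrite mulr0.
Qed.

(** An end gap exceeds [r] only if the [r] letters at that end are all nonsingular, an event of
    probability at most e/4, and it never exceeds [n]. Both ends together contribute at most 2r + 2n
    e/4. *)
Lemma Ex_find_small (e : R) : 0 < e -> exists n0, forall n j, (n0 <= n)%N ->
  Ex n j (fun w => (find (mem sing) w + find (mem sing) (rev w))%N%:R) <= e * n%:R.
Proof.
move=> e0; have [|r hr] := @Ex_none_small (e / 4); first by rewrite divr_gt0.
have [n0 hn0] : exists n0, forall n, (n0 <= n)%N -> (4 * r)%:R <= e * n%:R /\ (r <= n)%N.
  exists (Num.bound ((4 * r)%:R / e) + r)%N => n hn; split.
    rewrite mulrC -ler_pdivrMr//; apply: le_trans (ltW (archi_boundP _)) _.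
      by rewrite divr_ge0// ltW.
    by rewrite ler_nat (leq_trans _ hn)// leq_addr.
  by rewrite (leq_trans _ hn)// leq_addl.
exists n0 => n j /hn0[rn ltrn].
have fr w : size w = n ->
    (find (mem sing) w)%:R <= r%:R + n%:R * none (take r w) :> R.
  move=> sw; have [h|h] := boolP (has (mem sing) (take r w)).
    rewrite mulr0 addr0 ler_nat -[w](cat_take_drop r) find_cat h.
    by rewrite (leq_trans (find_size _ _))// size_take_min geq_minl.
  by rewrite mulr1 -natrD ler_nat (leq_trans (find_size _ _))// sw leq_addl.
have ngt0 : 0 <= n%:R :> R by [].
have E1 : Ex n j (fun w => none (take r w)) <= e / 4.
  rewrite -(subnKC ltrn) Ex_cat; apply: le_trans (hr j).
  apply: (le_Ex P_ge0) => w sw; apply: (Ex_le_bound P_ge0 P_sum1) => w' _.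
  by rewrite -sw take_size_cat.
have E2 : Ex n j (fun w => none (take r (rev w))) <= e / 4.
  rewrite -(subnK ltrn) Ex_cat; apply: (Ex_le_bound P_ge0 P_sum1) => w sw.
  apply: le_trans (hr (last j w)).
  apply: (le_Ex P_ge0) => w' sw'.
  by rewrite rev_cat -sw' -(size_rev w') take_size_cat// has_rev.
apply: (@le_trans _ _ (Ex n j (fun w => (r%:R + n%:R * none (take r w)) +
    (r%:R + n%:R * none (take r (rev w)))))).
  by apply: (le_Ex P_ge0) => w sw; rewrite natrD lerD ?fr ?size_rev.
rewrite !ExD !ExZ !Ex_cst//.
have := ler_wpM2l ngt0 E1; have := ler_wpM2l ngt0 E2; move: rn; rewrite natrM.
lra.
Qed.

(* S and T sandwich the same quantity up to an error of mean o(n), and the chain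
   forgets its initial state, so S and T have a common growth rate. *)
Lemma common_growth_rate S T (K : R) :
  subadd S -> subadd (fun w => - T w) ->
  (forall w, `|S w| <= K * (size w).+1%:R) ->
  (forall w, `|T w| <= K * (size w).+1%:R) ->
  (forall e : R, 0 < e -> exists n0, forall n j, (n0 <= n)%N ->
     Ex n j (fun w => S w - T w) <= e * n%:R) ->
  exists L : R, forall e : R, 0 < e ->
    (exists2 m, (0 < m)%N & forall j, Ex m j S <= (L + e) * m%:R) /\
    (exists2 m, (0 < m)%N & forall j, Ex m j (fun w => - T w) <= (- L + e) * m%:R).
Proof.
move=> sS sT SK TK ST.
have K0 : 0 <= K by have := SK [::]; rewrite mulr1; apply: le_trans.
(* [A] holds the rates that are valid from every initial state at some block length; its infimum
   will be [L]. *)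
pose A := [set c : R | exists2 m, (0 < m)%N & forall j, Ex m j S <= c * m%:R].
have bound m : (0 < m)%N -> K * m.+1%:R <= (2 * K) * m%:R.
  by move=> m0'; rewrite [2 * K]mulrC -mulrA ler_wpM2l// -natrM ler_nat mul2n -addnn -addn1 leq_add2l.
have A0 : A !=set0.
  exists (2 * K); exists 1%N => // j; apply: (Ex_le_bound P_ge0 P_sum1) => w sw.
  apply: le_trans (ler_norm _) _; apply: le_trans (SK _) _.
  by rewrite sw bound.
have Alb : lbound A (- (2 * K)).
  move=> c [m m1 hc].
  have : - (2 * K) * m%:R <= c * m%:R.
    apply: le_trans (hc ord0); apply: (Ex_ge_bound P_ge0 P_sum1) => w sw.
    rewrite mulNr lerNl; apply: le_trans (bound _ m1).
    by apply: le_trans (ler_norm _) _; rewrite normrN -sw.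
  by rewrite ler_pM2r// ltr0n.
have Ainf : has_inf A by split => //; exists (- (2 * K)).
exists (inf A) => e e0; split.
  have [c [m m1 hc] ce] := inf_adherent e0 Ainf.
  exists m => // j; apply: le_trans (hc j) _; rewrite ler_wpM2r//; exact: ltW.
(* The bound for [- T] compares [S] from one favourable state with [T] from any state. Each error
   gets a share e/5; [d] keeps the mixing error [d * (K * m.+1%:R)] within its share. *)
pose d := e / 5 / (K + 1).
have d0 : 0 < d by rewrite !divr_gt0//; lra.
have dK : d * K <= e / 5.
  by rewrite /d -mulrA ler_piMr ?divr_ge0 ?(ltW e0)// mulrC ler_pdivrMr; lra.
have [r hr] := mixing d0.
have [n0 hn0] := ST (e / 5) ltac:(lra).
pose m := (n0 + Num.bound ((2 * K * r.+1%:R + d * K) / (e / 5)) + 1)%N.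
have n0m : (n0 <= m)%N by rewrite /m -addnA leq_addr.
have mb : 2 * K * r.+1%:R + d * K <= e / 5 * m%:R.
  rewrite [leRHS]mulrC -ler_pdivrMr ?divr_gt0//.
  apply: le_trans (ltW (archi_boundP _)) _.
    by rewrite !(divr_ge0, addr_ge0, mulr_ge0) ?(ltW d0) ?(ltW e0).
  by rewrite ler_nat /m -addnA addnCA leq_addr.
have rm : (0 < r + m)%N by rewrite /m addn1 addnS.
exists (r + m)%N => // j'; rewrite ExN.
(* A rate below [inf A] fails at every positive block length, so at length [r + m] it fails from
   some initial state. *)
have [j hj] : exists j, (inf A - e / 5) * (r + m)%:R < Ex (r + m) j S.
  apply/not_existsP => h.
  have : A (inf A - e / 5).
    by exists (r + m)%N => // j; rewrite leNgt; apply/negP => /h.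
  move=> /(ge_inf (proj2 Ainf)); lra.
pose g i := Ex m i S.
have SB r' w : size w = r' -> `|S w| <= K * r'.+1%:R by move=> <-.
have TB r' w : size w = r' -> `|T w| <= K * r'.+1%:R by move=> <-.
have gB i : `|g i| <= K * m.+1%:R.
  rewrite ler_norml; apply/andP; split.
    apply: (Ex_ge_bound P_ge0 P_sum1) => w /SB.
    by rewrite ler_norml => /andP[].
  by apply: (Ex_le_bound P_ge0 P_sum1) => w /SB; rewrite ler_norml => /andP[].
(* Passage from [j] to [j']: the first [r] letters are dropped by subadditivity of [S], the state is
   forgotten by mixing, and [r] letters are put back by superadditivity of [T]. *)
have h1 : Ex (r + m) j S <= K * r.+1%:R + Ex r j (fun w => g (last j w)).
  rewrite Ex_cat -[X in X + _](Ex_cst P_sum1 r j) -ExD.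
  apply: (le_Ex P_ge0) => w /SB Sw.
  rewrite -[X in X + _](Ex_cst P_sum1 m (last j w)) -ExD.
  apply: (le_Ex P_ge0) => w' _; apply: le_trans (sS _ _) _.
  by rewrite lerD2r (le_trans (ler_norm _)).
have h2 := hr g _ gB j j'.
have h3 : Ex r j' (fun w => g (last j' w)) <= e / 5 * m%:R + K * r.+1%:R
    + Ex (r + m) j' T.
  rewrite Ex_cat -addrA -lerBlDl -[X in _ - X](Ex_cst P_sum1 r j').
  rewrite -ExN -ExD -[X in X + _](Ex_cst P_sum1 r j') -ExD.
  apply: (le_Ex P_ge0) => w /TB Tw.
  have := hn0 m (last j' w) n0m; rewrite ExD ExN => h.
  apply: (@le_trans _ _ (Ex m (last j' w) T)); first by rewrite /g; lra.
  rewrite -[X in X + _](Ex_cst P_sum1 m (last j' w)) -ExD.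
  apply: (le_Ex P_ge0) => w' _; have := sT w w'; move: Tw; rewrite ler_norml => /andP[].
  lra.
have h4 : d * (K * m.+1%:R) <= e / 5 * m%:R + d * K.
  by rewrite -natr1 mulrDr mulr1 mulrDr mulrA lerD2r ler_wpM2r.
move: hj mb h1 h2 h3 h4; rewrite natrD => hj mb h1 h2 h3 h4.
have r0 : 0 <= e * r%:R by rewrite mulr_ge0// ltW.
have m0' : 0 <= e * m%:R by rewrite mulr_ge0// ltW.
lra.
Qed.

(** The upper tail is that of [S]; on the lower side [T <= S] turns a small [S] into a large [- T],
    which is subadditive as well. The slack [b] leaves room for a change of norm. *)
Lemma sandwich_deviation S T (K b : R) :
  subadd S -> subadd (fun w => - T w) -> (forall w, T w <= S w) ->
  (forall w, `|S w| <= K * (size w).+1%:R) ->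
  (forall w, `|T w| <= K * (size w).+1%:R) ->
  (forall e : R, 0 < e -> exists n0, forall n j, (n0 <= n)%N ->
     Ex n j (fun w => S w - T w) <= e * n%:R) ->
  exists L : R, forall e : R, 0 < e -> exists C t : R, [/\ 0 < C, 0 < t & forall n j,
    Ex n j (fun w => (n%:R * e - b < `|S w - n%:R * L|)%R%:R) <= C * expR (- t * n%:R)].
Proof.
move=> sS sT TS SK TK ST.
have [L hL] := common_growth_rate sS sT SK TK ST.
exists L => e e0; have e2 : 0 < e / 2 by rewrite divr_gt0.
have [[m1 m1p h1] [m2 m2p h2]] := hL _ e2.
have [C1 [t1 [C10 t10 d1]]] := upper_deviation P_ge0 P_sum1 b sS SK m1p h1 e2.
have TK' w : `|- T w| <= K * (size w).+1%:R by rewrite normrN.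
have [C2 [t2 [C20 t20 d2]]] := upper_deviation P_ge0 P_sum1 b sT TK' m2p h2 e2.
exists (C1 + C2), (Num.min t1 t2); split; first exact: addr_gt0.
  by rewrite lt_min t10.
move=> n j.
apply: (@le_trans _ _ (Ex n j (fun w =>
    (n%:R * (L + e / 2 + e / 2) - b < S w)%R%:R +
    (n%:R * (- L + e / 2 + e / 2) - b < - T w)%R%:R))).
  apply: (le_Ex P_ge0) => w _; case: ltP => [h|_]; last by rewrite addr_ge0.
  have [hS|hS] := leP (n%:R * L) (S w).
    move: h; rewrite ger0_norm ?subr_ge0// => h.
    suff -> : (n%:R * (L + e / 2 + e / 2) - b < S w)%R by rewrite lerDl.
    lra.
  move: h; rewrite ltr0_norm ?subr_lt0// => h.
  suff -> : (n%:R * (- L + e / 2 + e / 2) - b < - T w)%R by rewrite lerDr.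
  have := TS w; lra.
rewrite ExD mulrDl lerD//.
  apply: le_trans (d1 n j) _; rewrite ler_pM2l// ler_expR ler_wpM2r// lerN2.
  by rewrite ge_min lexx.
apply: le_trans (d2 n j) _; rewrite ler_pM2l// ler_expR ler_wpM2r// lerN2.
by rewrite ge_min lexx orbT.
Qed.

End Mixing.

(** * Products of rank one and invertible matrices *)

Lemma split_first (T : Type) (p : pred T) (w : seq T) : has p w ->
  exists x y s, [/\ w = y ++ s :: x, p s, ~~ has p y & size y = find p w].
Proof.
elim: w => //= a w IH; case: ifP => [pa _|pa /= /IH[x [y [s [-> ps ny <-]]]]].
  by exists w, [::], a.
by exists x, (a :: y), s; rewrite /= pa.
Qed.

Lemma split_last (T : Type) (p : pred T) (w : seq T) : has p w ->
  exists x y s, [/\ w = x ++ s :: y, p s, ~~ has p y & size y = find p (rev w)].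
Proof.
rewrite -has_rev => /split_first[x [y [s [e ps ny sy]]]].
exists (rev x), (rev y), s; rewrite has_rev size_rev; split => //.
by rewrite -[LHS]revK e rev_cat rev_cons cat_rcons.
Qed.

(** * The entrywise norm and its behaviour under multiplication *)

Section EntrywiseNorm.
Variable R : realType.

Definition l1 m n (M : 'M[R]_(m, n)) : R := \sum_i \sum_j `|M i j|.

Lemma l1_ge0 m n (M : 'M[R]_(m, n)) : 0 <= l1 M.
Proof. by apply: sumr_ge0 => i _; apply: sumr_ge0. Qed.

Lemma l1_entry m n (M : 'M[R]_(m, n)) i j : `|M i j| <= l1 M.
Proof.
rewrite /l1 (bigD1 i)//= (bigD1 j)//= -addrA lerDl addr_ge0 ?sumr_ge0// => i' _.
exact: sumr_ge0.
Qed.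

Lemma l1_gt0 m n (M : 'M[R]_(m, n)) : M != 0 -> 0 < l1 M.
Proof.
move=> M0; rewrite lt_neqAle l1_ge0 andbT eq_sym; apply: contra M0 => /eqP M0.
apply/eqP/matrixP => i j; rewrite mxE; apply/normr0_eq0/le_anti.
by rewrite normr_ge0 andbT -M0 l1_entry.
Qed.

Lemma l1_mul m n p (M : 'M[R]_(m, n)) (N : 'M[R]_(n, p)) :
  l1 (M *m N) <= l1 M * l1 N.
Proof.
rewrite /l1 mulr_suml; apply: ler_sum => i _.
apply: (@le_trans _ _ (\sum_j \sum_l `|M i l| * `|N l j|)).
  apply: ler_sum => j _; rewrite mxE; apply: le_trans (ler_norm_sum _ _ _) _.
  by apply: ler_sum => l _; rewrite normrM.
rewrite exchange_big /= mulr_suml; apply: ler_sum => l _.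
rewrite -mulr_sumr ler_wpM2l// (bigD1 l)//= lerDl; apply: sumr_ge0 => i' _.
exact: sumr_ge0.
Qed.

Lemma l1_outer m n (a : 'cV[R]_m) (c : 'rV[R]_n) : l1 (a *m c) = l1 a * l1 c.
Proof.
rewrite /l1 big_ord1 mulr_suml; apply: eq_bigr => i _.
rewrite big_ord1 mulr_sumr; apply: eq_bigr => j _.
by rewrite mxE big_ord1 normrM.
Qed.

Lemma l1Z m n t (M : 'M[R]_(m, n)) : l1 (t *: M) = `|t| * l1 M.
Proof.
rewrite /l1 mulr_sumr; apply: eq_bigr => i _; rewrite mulr_sumr.
by apply: eq_bigr => j _; rewrite mxE normrM.
Qed.

Lemma l1_1 : l1 (1%:M : 'M[R]_2) = 2.
Proof. by rewrite /l1 !big_ord_recl !big_ord0 !mxE /= !normr0 normr1; ring. Qed.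

Lemma l1_adj (M : 'M[R]_2) : l1 (\adj M) <= 4 * l1 M.
Proof.
have h i j : `|(\adj M) i j| <= l1 M.
  rewrite mxE /cofactor normrM normrX normrN1 expr1n mul1r det_mx11 !mxE.
  exact: l1_entry.
rewrite {1}/l1 !big_ord_recl !big_ord0.
have := h ord0 ord0; have := h ord0 (lift ord0 ord0).
have := h (lift ord0 ord0) ord0; have := h (lift ord0 ord0) (lift ord0 ord0).
lra.
Qed.

(** Multiplication by the adjugate undoes [A] up to the scalar [\det A]. *)
Lemma l1_mul_det m (M : 'M[R]_(m, 2)) (A : 'M[R]_2) :
  `|\det A| * l1 M <= 4 * l1 A * l1 (M *m A).
Proof.
rewrite -l1Z -mul_mx_scalar -mul_mx_adj mulmxA mulrC.
by apply: le_trans (l1_mul _ _) _; rewrite ler_wpM2l ?l1_ge0// l1_adj.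
Qed.

Lemma l1_det_mul m (M : 'M[R]_(2, m)) (A : 'M[R]_2) :
  `|\det A| * l1 M <= 4 * l1 A * l1 (A *m M).
Proof.
rewrite -l1Z -mul_scalar_mx -mul_adj_mx -mulmxA.
by apply: le_trans (l1_mul _ _) _; rewrite ler_wpM2r ?l1_ge0// l1_adj.
Qed.

End EntrywiseNorm.

(** The head of a word is its earliest letter, hence the rightmost factor; [Ex] reads words in the
    same order. *)
Fixpoint wmat (R : realType) (k : nat) (A : 'I_k.+1 -> 'M[R]_2)
    (w : seq 'I_k.+1) : 'M[R]_2 :=
  if w is i :: w' then wmat A w' *m A i else 1%:M.

Lemma wmat_cat (R : realType) (k : nat) (A : 'I_k.+1 -> 'M[R]_2) w w' :
  wmat A (w ++ w') = wmat A w' *m wmat A w.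
Proof. by elim: w => [|i w IH] /=; rewrite ?mulmx1// IH mulmxA. Qed.

Lemma cocycle_wmat (R : realType) (k : nat) (A : 'I_k.+1 -> 'M[R]_2) om n :
  cocycle A om n = wmat A [seq om (i.+1 : nat)%:Z | i <- iota 0 n].
Proof.
elim: n => // n IH; have -> : iota 0 n.+1 = iota 0 n ++ [:: n] by rewrite -addn1 iotaD.
by rewrite map_cat wmat_cat /= mul1mx IH.
Qed.

(** For empty [y] this bounds the pairing of [v s'] with [u s] itself, whence the successor in the
    exponent. *)
Definition nonresonant (R : realType) (k : nat) (A : 'I_k.+1 -> 'M[R]_2)
    (sing : {set 'I_k.+1}) (u : 'I_k.+1 -> 'cV[R]_2) (v : 'I_k.+1 -> 'rV[R]_2) :=
  exists2 tau : R, 0 < tau <= 1 & forall s s' y, s \in sing -> s' \in sing ->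
    ~~ has (mem sing) y ->
    tau ^+ (size y).+1 <= `|(v s' *m wmat A y *m u s) 0 0|.

Section Products.
Variables (R : realType) (k : nat) (A : 'I_k.+1 -> 'M[R]_2).
Variables (sing : {set 'I_k.+1}).
Local Notation M := (wmat A).
Local Notation none w := (~~ has (mem sing) w).

Section Invertible.
Variable kap : R.
Hypothesis kap0 : 0 <= kap.

Lemma l1_none_r m (N : 'M[R]_(m, 2)) w :
  (forall j, j \notin sing -> forall m (N : 'M[R]_(m, 2)), l1 N <= kap * l1 (N *m A j)) ->
  none w -> l1 N <= kap ^+ size w * l1 (N *m M w).
Proof.
move=> h; elim: w => [|i w IH] /=; first by rewrite expr0 mul1r mulmx1.
rewrite negb_or => /andP[ni /IH hw]; apply: le_trans hw _.
rewrite exprSr -mulrA ler_wpM2l ?exprn_ge0// mulmxA; exact: h.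
Qed.

Lemma l1_none_l m (N : 'M[R]_(2, m)) w :
  (forall j, j \notin sing -> forall m (N : 'M[R]_(2, m)), l1 N <= kap * l1 (A j *m N)) ->
  none w -> l1 N <= kap ^+ size w * l1 (M w *m N).
Proof.
move=> h; elim: w N => [|i w IH] N /=; first by rewrite expr0 mul1r mul1mx.
rewrite negb_or => /andP[ni /IH hw]; apply: le_trans (h i ni _ N) _.
rewrite exprS -mulrA ler_wpM2l//.
by have := hw (A i *m N); rewrite mulmxA.
Qed.

End Invertible.

Lemma l1_wmat_le W w : 0 <= W -> (forall i, l1 (A i) <= W) ->
  l1 (M w) <= 2 * W ^+ size w.
Proof.
move=> W0 AW; elim: w => [|i w IH] /=; first by rewrite l1_1 expr0 mulr1.
apply: le_trans (l1_mul _ _) _; rewrite exprSr mulrA.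
by apply: ler_pM => //; apply: l1_ge0.
Qed.

Variables (u : 'I_k.+1 -> 'cV[R]_2) (v : 'I_k.+1 -> 'rV[R]_2).
Hypothesis A_sing : forall s, s \in sing -> A s = u s *m v s.
Hypothesis sing_ne0 : exists s, s \in sing.
Hypothesis A_inv : forall j, j \notin sing -> \det (A j) != 0.
Hypothesis NR : nonresonant A sing u v.

(** The row [v s *m M y] is carried through the product from the latest letter on. A nonsingular
    letter lengthens [y]; a singular one splits off a pairing, nonzero by [NR], and restarts with
    empty [y]. *)
Lemma wmat_neq0 w : M w != 0.
Proof.
have [tau /andP[t0 _] ht] := NR.
suff h s y : s \in sing -> none y -> v s *m M y *m M w != 0.
  have [s ss] := sing_ne0; have := @h s [::] ss isT.
  by apply: contra => /eqP ->; rewrite mulmx0.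
have nz r r' z : r \in sing -> r' \in sing -> none z ->
    (v r' *m M z *m u r) 0 0 != 0.
  by move=> rs rs' nz; rewrite -normr_gt0 (lt_le_trans _ (ht _ _ _ rs rs' nz))// exprn_gt0.
elim/last_ind: w s y => [|w i IH] s y ss ny.
  have := nz _ _ _ ss ss ny; apply: contra => /eqP.
  by rewrite /= mulmx1 => ->; rewrite mul0mx mxE.
rewrite -cats1 wmat_cat /= mul1mx; have [si|si] := boolP (i \in sing).
  rewrite (A_sing si) !mulmxA (mx11_scalar (v s *m M y *m u i)) mul_scalar_mx -scalemxAl.
  rewrite scalemx_eq0 negb_or nz//=.
  by have := IH i [::] si isT; rewrite /= mulmx1.
have := IH s (i :: y) ss; rewrite /= negb_or => /(_ _)/=.
by rewrite !mulmxA; apply; apply/andP.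
Qed.

Definition logN w : R := ln (l1 (M w)).

Lemma logN_cat_le w w' : logN (w ++ w') <= logN w + logN w'.
Proof.
have p x : 0 < l1 (M x) by rewrite l1_gt0// wmat_neq0.
rewrite /logN -lnM ?posrE// ler_ln ?posrE ?mulr_gt0//.
by rewrite wmat_cat mulrC l1_mul.
Qed.

(* Any singular letter makes the product rank one, so gluing two words costs only
   the pairing of v and u across the gap around the junction. *)
Lemma exists_gap_cost : exists E : R, [/\ 1 <= E,
  forall w w', none w -> l1 (M w') <= E ^+ size w * l1 (M (w ++ w')),
  forall w w', none w' -> l1 (M w) <= E ^+ size w' * l1 (M (w ++ w')),
  forall w, l1 (M w) <= 2 * E ^+ size w &
  forall w w', has (mem sing) w -> has (mem sing) w' ->
   l1 (M w) * l1 (M w') <=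
    E ^+ (find (mem sing) (rev w) + find (mem sing) w').+1 * l1 (M (w ++ w'))].
Proof.
have [tau /andP[t0 t1] ht] := NR.
pose W := 1 + \sum_i (l1 (A i) + l1 (u i) + l1 (v i)).
have Wi i : l1 (A i) + l1 (u i) + l1 (v i) <= \sum_i (l1 (A i) + l1 (u i) + l1 (v i)).
  by rewrite [leRHS](bigD1 i)//= lerDl; apply: sumr_ge0 => j _; rewrite !addr_ge0 ?l1_ge0.
have W1 : 1 <= W.
  by rewrite lerDl; apply: sumr_ge0 => j _; rewrite !addr_ge0 ?l1_ge0.
have [AW uW vW] : [/\ forall i, l1 (A i) <= W, forall i, l1 (u i) <= W &
    forall i, l1 (v i) <= W].
  by split=> i; have := Wi i; rewrite /W; have := l1_ge0 (A i); have := l1_ge0 (u i);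
     have := l1_ge0 (v i); lra.
(* [kap] dominates the loss that [l1_mul_det] and [l1_det_mul] allow for one invertible letter. *)
pose kap := 1 + \sum_(j | j \notin sing) 4 * W / `|\det (A j)|.
have kap1 : 1 <= kap.
  by rewrite lerDl; apply: sumr_ge0 => j _; rewrite divr_ge0 ?mulr_ge0//; lra.
have kapj j (x y : R) : j \notin sing -> 0 <= y ->
    `|\det (A j)| * x <= 4 * l1 (A j) * y -> x <= kap * y.
  move=> nj y0 h; have d0 : 0 < `|\det (A j)| by rewrite normr_gt0 A_inv.
  apply: (@le_trans _ _ (4 * W / `|\det (A j)| * y)).
    rewrite mulrAC ler_pdivlMr// mulrC; apply: le_trans h _.
    by rewrite ler_wpM2r// ler_wpM2l.
  rewrite ler_wpM2r// /kap (bigD1 j)//= addrCA lerDl addr_ge0//.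
  by apply: sumr_ge0 => i _; rewrite divr_ge0 ?mulr_ge0//; lra.
have W0 : 0 <= W by lra.
have kap0 : 0 <= kap by lra.
(* One [F] per gap letter, and one more, pays for the power of [tau] and for the norms of [u], [v]
   and the gap letters. *)
pose F := 4 * W ^+ 3 / tau.
have F1 : 1 <= F.
  rewrite /F ler_pdivlMr// mul1r (le_trans t1)//.
  have : 1 <= W ^+ 3 by rewrite exprn_ege1.
  lra.
pose E := kap * F.
have kE : kap <= E by rewrite ler_peMr.
have FE : F <= E by rewrite ler_peMl//; lra.
have E1 : 1 <= E by lra.
have WF : W <= F.
  rewrite /F ler_pdivlMr//; apply: (@le_trans _ _ W); first by rewrite ler_piMr.
  have : W <= W ^+ 3 by rewrite ler_eXnr.
  lra.
have WE : W <= E by lra.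
have kpow n : kap ^+ n <= E ^+ n by rewrite lerXn2r ?nnegrE//; lra.
exists E; split => //.
- move=> w w' nw; rewrite wmat_cat.
  apply: (le_trans (@l1_none_r kap kap0 _ (M w') w _ nw)).
    by move=> j nj m N; apply: (kapj j) => //; [apply: l1_ge0 | apply: l1_mul_det].
  by rewrite ler_wpM2r ?l1_ge0.
- move=> w w' nw; rewrite wmat_cat.
  apply: (le_trans (@l1_none_l kap kap0 _ (M w) w' _ nw)).
    by move=> j nj m N; apply: (kapj j) => //; [apply: l1_ge0 | apply: l1_det_mul].
  by rewrite ler_wpM2r ?l1_ge0.
- move=> w; apply: le_trans (l1_wmat_le _ W0 AW) _.
  by rewrite ler_wpM2l// lerXn2r ?nnegrE//; lra.
move=> w w' /split_last[x [y [s [-> ss ny <-]]]] /split_first[x' [y' [s' [-> ss' ny' <-]]]].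
rewrite !inE in ss ss'.
pose a := M y *m u s; pose c := v s *m M x.
pose a' := M x' *m u s'; pose c' := v s' *m M y'.
have e1 : M (x ++ s :: y) = a *m c by rewrite wmat_cat /= A_sing// !mulmxA.
have e2 : M (y' ++ s' :: x') = a' *m c' by rewrite wmat_cat /= A_sing// !mulmxA.
pose t := (c' *m a) 0 0.
have tE : t = (v s' *m M (y ++ y') *m u s) 0 0.
  by rewrite /t /c' /a wmat_cat !mulmxA.
have nyy : none (y ++ y') by rewrite has_cat negb_or ny.
have tt := ht _ _ _ ss ss' nyy; rewrite -tE size_cat in tt.
have -> : l1 (M ((x ++ s :: y) ++ y' ++ s' :: x')) = `|t| * (l1 a' * l1 c).
  rewrite wmat_cat e1 e2 mulmxA -[a' *m c' *m a]mulmxA (mx11_scalar (c' *m a)).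
  by rewrite mul_mx_scalar -scalemxAl l1Z l1_outer.
rewrite e1 e2 !l1_outer.
(* The outer factors [l1 a'] and [l1 c] occur on both sides, so only [l1 a * l1 c'] has to be
   compared with the pairing [t]. *)
have -> : l1 a * l1 c * (l1 a' * l1 c') = l1 a * l1 c' * (l1 a' * l1 c) by ring.
rewrite [leRHS]mulrA ler_wpM2r ?mulr_ge0 ?l1_ge0//.
set n := (size y + size y')%N.
have ha : l1 a <= 2 * W ^+ size y * W.
  by apply: le_trans (l1_mul _ _) _; apply: ler_pM; rewrite ?l1_ge0 ?l1_wmat_le.
have hc : l1 c' <= W * (2 * W ^+ size y').
  by apply: le_trans (l1_mul _ _) _; apply: ler_pM; rewrite ?l1_ge0 ?l1_wmat_le.
apply: (@le_trans _ _ (4 * W ^+ 2 * W ^+ n)).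
  apply: (@le_trans _ _ (2 * W ^+ size y * W * (W * (2 * W ^+ size y')))).
    by apply: ler_pM; rewrite ?l1_ge0.
  by rewrite /n exprD; rewrite le_eqVlt; apply/orP; left; apply/eqP; ring.
apply: (@le_trans _ _ (F ^+ n.+1 * tau ^+ n.+1)); last first.
  apply: ler_pM => //; first by rewrite exprn_ge0//; lra.
    by rewrite exprn_ge0// ltW.
  by rewrite lerXn2r ?nnegrE//; lra.
have t0' : tau != 0 by rewrite gt_eqF.
rewrite -exprMn /F divfK// [leRHS]exprS.
have W23 : W ^+ 2 <= W ^+ 3 by rewrite ler_weXn2l.
have W23' : 0 <= W ^+ 2 by rewrite exprn_ge0.
have W3 : 4 * W ^+ 2 <= 4 * W ^+ 3 by lra.
apply: ler_pM => //; rewrite ?mulr_ge0 ?exprn_ge0//.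
rewrite lerXn2r ?nnegrE ?mulr_ge0 ?exprn_ge0//.
have : W <= W ^+ 3 by rewrite ler_eXnr.
lra.
Qed.

(* T is logN minus a multiple of the lengths of the singular-free ends of the word;
   this penalty absorbs exists_gap_cost and makes T superadditive. *)
Lemma exists_minorant : exists (T : seq 'I_k.+1 -> R) (K : R),
  [/\ subadd (fun w => - T w), forall w, T w <= logN w,
   forall w, `|logN w| <= K * (size w).+1%:R,
   forall w, `|T w| <= K * (size w).+1%:R &
   forall w, logN w - T w <=
     K * (find (mem sing) w + find (mem sing) (rev w)).+1%:R].
Proof.
have [E [E1 hr hl hW hg]] := exists_gap_cost.
have p x : 0 < l1 (M x) by rewrite l1_gt0// wmat_neq0.
have E0 : 0 < E by lra.
pose K := ln E; have K0 : 0 <= K by rewrite ln_ge0.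
have lnE n : ln (E ^+ n) = K * n%:R by rewrite lnXn// mulr_natr.
have En n : 0 < E ^+ n by rewrite exprn_gt0.
have lr w w' : none w -> logN w' <= K * (size w)%:R + logN (w ++ w').
  by move=> /hr h; rewrite -lnE -lnM ?posrE// ler_ln ?posrE ?mulr_gt0.
have ll w w' : none w' -> logN w <= K * (size w')%:R + logN (w ++ w').
  by move=> /hl h; rewrite -lnE -lnM ?posrE// ler_ln ?posrE ?mulr_gt0.
have lW w : logN w <= ln 2 + K * (size w)%:R.
  by rewrite -lnE -lnM ?posrE// ler_ln ?posrE ?mulr_gt0.
have lg w w' : has (mem sing) w -> has (mem sing) w' -> logN w + logN w' <=
    K * (find (mem sing) (rev w) + find (mem sing) w').+1%:R + logN (w ++ w').
  move=> h h'; rewrite -lnE -!lnM ?posrE// ler_ln ?posrE ?mulr_gt0//.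
  exact: hg.
pose gap w : nat := (find (mem sing) w + find (mem sing) (rev w))%N.
(* On words without singular letters [T] is additive. Of the [2 * K] per letter, one [K] pays for
   the norm lost when such a word is attached to another, the other for the longer end gap. *)
pose T w := if has (mem sing) w then logN w - K * (gap w).+1%:R
            else - (2 * K) * (size w)%:R.
have KN n : 0 <= K * n%:R by rewrite mulr_ge0.
have Tsup w w' : T w + T w' <= T (w ++ w').
  rewrite /T /gap rev_cat !has_cat !find_cat !has_rev !size_rev.
  have [h|h] := boolP (has (mem sing) w); have [h'|h'] := boolP (has (mem sing) w') => /=.
  - have := lg _ _ h h'; rewrite -!natr1 !natrD; lra.
  - have := ll w _ h'; have := KN (size w'); rewrite -!natr1 !natrD; lra.
  - have := lr _ w' h; have := KN (size w); rewrite -!natr1 !natrD; lra.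
  - by rewrite size_cat natrD; rewrite le_eqVlt; apply/orP; left; apply/eqP; ring.
have ln2 : 0 <= ln 2 :> R by rewrite ln_ge0//; lra.
have TS w : T w <= logN w.
  rewrite /T; case: ifPn => h; first by rewrite gerBl.
  have := lr w [::] h; rewrite cats0 /logN /= l1_1; have := KN (size w).
  lra.
pose K4 := \sum_i `|T [:: i]|.
have K40 : 0 <= K4 by apply: sumr_ge0.
have Tlow w : - (K4 * (size w)%:R) <= T w.
  elim: w => [|i w IH]; first by rewrite /T /= !mulr0 oppr0.
  have := Tsup [:: i] w; rewrite /= -natr1.
  have : `|T [:: i]| <= K4 by rewrite [leRHS](bigD1 i)//= lerDl; apply: sumr_ge0.
  by rewrite ler_norml => /andP[h _] h2; lra.
exists T, (K4 + ln 2 + 2 * K); split => //.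
- by move=> w w'; rewrite -opprD lerN2.
- move=> w; rewrite ler_norml -natr1; have := Tlow w; have := TS w; have := lW w.
  have := KN (size w); have := mulr_ge0 ln2 (ler0n R (size w)).
  have := mulr_ge0 K40 (ler0n R (size w)).
  move=> *; apply/andP; split; lra.
- move=> w; rewrite ler_norml -natr1; have := Tlow w; have := TS w; have := lW w.
  have := KN (size w); have := mulr_ge0 ln2 (ler0n R (size w)).
  have := mulr_ge0 K40 (ler0n R (size w)).
  move=> *; apply/andP; split; lra.
- move=> w; rewrite -/(gap w) -natr1; have := KN (gap w).
  have := mulr_ge0 ln2 (ler0n R (gap w)); have := mulr_ge0 K40 (ler0n R (gap w)).
  rewrite /T; case: ifPn => [h|h]; first by rewrite -natr1; lra.
  have -> : gap w = (size w + size w)%N.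
    by rewrite /gap !hasNfind ?has_rev// size_rev.
  have := lW w; have := KN (size w); rewrite natrD; lra.
Qed.

End Products.

(** * Null sets by box coverings *)

Lemma sum_pickle_le (R : realType) (T : countType) (g : T -> R) (s : seq T) m :
  (forall x, 0 <= g x) ->
  (forall n x, (n < m)%N -> pickle_inv n = Some x -> x \in s) ->
  \sum_(n < m) oapp g 0 (pickle_inv n) <= \sum_(x <- s) g x.
Proof.
move=> g0 hs.
apply: (@le_trans _ _ (\sum_(n < m) \sum_(x <- s) (pickle x == n)%:R * g x)).
  apply: ler_sum => n _; case e: pickle_inv => [x|] /=; last first.
    by apply: sumr_ge0 => x _; rewrite mulr_ge0.
  have pn : pickle x = n by have := @pickle_invK T n; rewrite e.
  rewrite (big_rem x) ?(hs n)//= pn eqxx mul1r lerDl.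
  by apply: sumr_ge0 => y _; rewrite mulr_ge0.
rewrite exchange_big /=; apply: ler_sum => x _; rewrite -mulr_suml.
rewrite ler_piMl//; have [lt|ge] := ltnP (pickle x) m.
  rewrite (bigD1 (Ordinal lt))//= eqxx big1 ?addr0// => n.
  by rewrite -val_eqE /= eq_sym => /negPf ->.
rewrite big1// => n _; case: eqP => // e.
by move: ge; rewrite e leqNgt ltn_ord.
Qed.

Lemma sum_half_powers_le1 (R : realType) m : \sum_(n < m) (1 / 2) ^+ n.+1 <= 1 :> R.
Proof.
suff -> : \sum_(n < m) (1 / 2) ^+ n.+1 = 1 - (1 / 2) ^+ m :> R.
  by rewrite gerBl exprn_ge0//; lra.
elim: m => [|m IH]; first by rewrite big_ord0 expr0 subrr.
by rewrite big_ord_recr /= IH exprSr; field.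
Qed.

Section BoxCoverings.
Variables (R : realType) (D : finType) (d1 : D).
Implicit Types (E : set (D -> R)) (a b x y : D -> R).

Definition box a b : set (D -> R) := [set x | forall j, a j <= x j <= b j].

(** A covering certificate for outer measure at most [c]; [lebesgue_null E] asks for [covers E eps]
    at every positive [eps]. *)
Definition covers E (c : R) := exists a b : nat -> D -> R,
  (forall n j, a n j <= b n j) /\ E `<=` \bigcup_n box (a n) (b n) /\
  forall m, \sum_(n < m) \prod_j (b n j - a n j) <= c.

Lemma covers_sub E E' c c' : E' `<=` E -> c <= c' -> covers E c -> covers E' c'.
Proof.
move=> EE cc [a [b [ab [Eab s]]]]; exists a, b; split=> //; split.
  exact: subset_trans EE Eab.
by move=> m; apply: le_trans cc.
Qed.

Lemma covers_ge0 E c : covers E c -> 0 <= c.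
Proof. by move=> [a [b [_ [_ /(_ 0%N)]]]]; rewrite big_ord0. Qed.

(** One-point boxes serve as padding here and below. Their volume is 0 because [d1] inhabits [D]; an
    empty product would be 1. *)
Lemma covers_set0 c : 0 <= c -> covers set0 c.
Proof.
move=> c0; exists (fun=> cst 0), (fun=> cst 0); split => //; split => [x []|m].
by rewrite big1// => n _; rewrite (bigD1 d1)//= subrr mul0r.
Qed.

Lemma covers_box a b : (forall j, a j <= b j) ->
  covers (box a b) (\prod_j (b j - a j)).
Proof.
move=> ab; exists (fun n => if n is 0%N then a else cst 0),
  (fun n => if n is 0%N then b else cst 0); split; first by case.
split; first by move=> x xab; exists 0%N.
case=> [|m]; first by rewrite big_ord0 prodr_ge0// => j _; rewrite subr_ge0.
rewrite big_ord_recl [X in _ + X]big1 ?addr0// => n _ /=.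
by rewrite (bigD1 d1)//= subrr mul0r.
Qed.

Lemma covers_countable (I : countType) (E : I -> set (D -> R)) (c : I -> R) C :
  (forall i, covers (E i) (c i)) ->
  (forall n, \sum_(i <- pmap (@pickle_inv I) (iota 0 n)) c i <= C) ->
  covers (\bigcup_i E i) C.
Proof.
move=> /choice[a /choice[b ab]] cC.
pose f i j := \prod_d (b i j d - a i j d).
have f0 i j : 0 <= f i j.
  by rewrite prodr_ge0// => d _; rewrite subr_ge0; have [] := ab i.
pose a' n := if pickle_inv n is Some (i, j) then a i j else cst 0.
pose b' n := if pickle_inv n is Some (i, j) then b i j else cst 0.
exists a', b'; split.
  move=> n d; rewrite /a' /b'; case: pickle_inv => // -[i j].
  by have [] := ab i.
split.
  move=> x [i _ Eix]; have [_ [/(_ x Eix)[j _ xij] _]] := ab i.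
  by exists (pickle (i, j)) => //; rewrite /a' /b' pickleK_inv.
move=> m.
have -> : \sum_(n < m) \prod_d (b' n d - a' n d) =
    \sum_(n < m) oapp (fun ij : I * nat => f ij.1 ij.2) 0 (pickle_inv n).
  apply: eq_bigr => n _; rewrite /a' /b'; case: pickle_inv => [[i j]//|] /=.
  by rewrite (bigD1 d1)//= subrr mul0r.
(* All pairs decoded from codes below [m] lie in a square of side [M], over which the sum splits
   into partial sums of the given coverings. *)
pose M := (\max_(n < m) oapp (fun ij : I * nat => maxn (pickle ij.1) ij.2) 0%N
  (pickle_inv n)).+1.
pose s := [seq (i, j) | i <- pmap (@pickle_inv I) (iota 0 M), j <- iota 0 M].
apply: (@le_trans _ _ (\sum_(x <- s) f x.1 x.2)).
  apply: (sum_pickle_le (g := fun ij : I * nat => f ij.1 ij.2)) => // n [i j] nm e.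
  have : (maxn (pickle i) j < M)%N.
    rewrite ltnS; apply: leq_trans (leq_bigmax (Ordinal nm)).
    by rewrite /= e.
  rewrite gtn_max => /andP[iM jM]; apply/allpairsP; exists (i, j).
  rewrite mem_iota [X in X && _]leq0n jM mem_pmap; split => //; apply/mapP.
  exists (pickle i).
    by rewrite mem_iota.
  by rewrite pickleK_inv.
rewrite big_allpairs; apply: le_trans (cC M); apply: ler_sum => i _.
have [_ [_ /(_ M)]] := ab i; rewrite -(big_mkord xpredT (f i)).
by rewrite /index_iota subn0.
Qed.

Lemma covers_bigcup (E : nat -> set (D -> R)) (c : nat -> R) C :
  (forall n, covers (E n) (c n)) -> (forall m, \sum_(n < m) c n <= C) ->
  covers (\bigcup_n E n) C.
Proof.
move=> Ec cC; apply: (covers_countable Ec) => n.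
have -> : pmap (@pickle_inv nat) (iota 0 n) = iota 0 n.
  by elim: (iota 0 n) => //= i s ->; rewrite pickleK_inv.
by rewrite -[X in iota 0 X](subn0 n) big_mkord.
Qed.

Lemma covers_fin (I : finType) (E : I -> set (D -> R)) (c : I -> R) :
  (forall i, covers (E i) (c i)) -> covers (\bigcup_i E i) (\sum_i c i).
Proof.
move=> Ec; apply: (covers_countable Ec) => n.
have c0 i : 0 <= c i by exact: covers_ge0 (Ec i).
rewrite big_pmap -[X in iota 0 X](subn0 n) big_mkord.
apply: le_trans (sum_pickle_le (s := index_enum I) c0 _) _ => //.
by move=> *; exact: mem_index_enum.
Qed.

(* Cut the coordinates other than d0 by a grid of mesh at most h: above each cell
   the set has height at most r in the direction d0. *)
Lemma slab_covers d0 (N r h : R) E : 0 < N -> 0 <= r -> 0 < h ->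
  (forall x, E x -> forall d, `|x d| <= N) ->
  (forall x y, E x -> E y -> (forall d, d != d0 -> `|x d - y d| <= h) ->
     `|x d0 - y d0| <= r) ->
  covers E (\prod_d (if d == d0 then 2 * r else 2 * N)).
Proof.
move=> N0 r0 h0 EN Eh.
pose M := Num.bound (2 * N / h); pose s : R := 2 * N / M.+1%:R.
have M0 : (0 : R) < M.+1%:R by [].
have s0 : 0 <= s by rewrite divr_ge0//; lra.
have sh : s <= h.
  rewrite /s ler_pdivrMr// [leRHS]mulrC -ler_pdivrMr//.
  apply: le_trans (ltW (archi_boundP _)) _; first by rewrite divr_ge0//; lra.
  by rewrite ler_nat leqnSn.
have grid t : `|t| <= N ->
    exists i : 'I_M.+1, - N + s * (i : nat)%:R <= t <= - N + s * (i.+1)%:R.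
  rewrite ler_norml => /andP[t1 t2].
  have {}t2 : t <= - N + s * M.+1%:R by rewrite /s divfK ?gt_eqF//; lra.
  suff [i iM ti] : exists2 i, (i < M.+1)%N & - N + s * i%:R <= t <= - N + s * i.+1%:R.
    by exists (Ordinal iM).
  elim: (M) t2 => [|m IH] t2.
    by exists 0%N => //; rewrite mulr0 addr0 t1 t2.
  have [/IH[i im ti]|h'] := leP t (- N + s * m.+1%:R).
    by exists i => //; exact: ltnW.
  by exists m.+1 => //; rewrite (ltW h') t2.
pose cell (c : {ffun D -> 'I_M.+1}) x := forall d, d != d0 ->
  - N + s * (c d : nat)%:R <= x d <= - N + s * (c d).+1%:R.
have [t ht] : exists t : {ffun D -> 'I_M.+1} -> R, forall (c : {ffun D -> 'I_M.+1}) x, E x -> cell c x ->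
    `|x d0 - t c| <= r.
  (* The centre is the height of any point of the set above the cell, with default 0 when there is
     none. *)
  suff H (c : {ffun D -> 'I_M.+1}) : exists tc : R, forall x, E x -> cell c x -> `|x d0 - tc| <= r.
    by have [t ht] := choice H; exists t.
  have [[y [Ey cy]]|ny] := pselect (exists y, E y /\ cell c y).
    exists (y d0) => x Ex cx; apply: Eh => // d dd0.
    apply: le_trans sh; have := cx d dd0; have := cy d dd0; rewrite ler_norml -natr1.
    by move=> /andP[? ?] /andP[? ?]; apply/andP; split; lra.
  by exists 0 => x Ex cx; case: ny; exists x.
(* Cells are indexed by functions on all of [D], and the value at [d0] is redundant: only [ord0]
   carries the true box, any other value a box of zero height. *)
pose a (c : {ffun D -> 'I_M.+1}) d := if d == d0 then (if c d0 == ord0 then t c - r else 0)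
              else - N + s * (c d : nat)%:R.
pose b (c : {ffun D -> 'I_M.+1}) d := if d == d0 then (if c d0 == ord0 then t c + r else 0)
              else - N + s * (c d).+1%:R.
have ab (c : {ffun D -> 'I_M.+1}) d : a c d <= b c d.
  rewrite /a /b -natr1; case: ifP => _; first by case: ifP => _ //; lra.
  by lra.
have := covers_fin (fun c : {ffun D -> 'I_M.+1} => @covers_box (a c) (b c) (ab c)); apply: covers_sub.
  move=> x Ex; have /choice[c hc] := fun d => grid (x d) (EN x Ex d).
  exists [ffun d => if d == d0 then ord0 else c d] => // d.
  rewrite /a /b !ffunE; case: (eqVneq d d0) => [->|dd0].
    rewrite !eqxx; have : `|x d0 - t [ffun d => if d == d0 then ord0 else c d]| <= r.
      by apply: ht => // d' dd'; rewrite ffunE (negPf dd').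
    by rewrite ler_norml => /andP[? ?]; apply/andP; split; lra.
  exact: hc.
pose g d (i : 'I_M.+1) : R := if d == d0 then (if i == ord0 then 2 * r else 0) else s.
have -> : \sum_(c : {ffun D -> 'I_M.+1}) \prod_d (b c d - a c d) = \sum_(c : {ffun D -> 'I_M.+1}) \prod_d g d (c d).
  apply: eq_bigr => c _; apply: eq_bigr => d _; rewrite /a /b /g.
  have [->|_] := eqVneq d d0; last by rewrite -natr1; ring.
  by case: ifP => _; ring.
rewrite -bigA_distr_bigA le_eqVlt; apply/orP; left; apply/eqP.
apply: eq_bigr => d _; rewrite /g; case: ifP => _.
  by rewrite (bigD1 ord0)//= big1 ?addr0// => i /negPf ->.
by rewrite sumr_const card_ord -[LHS]mulr_natr /s divfK// gt_eqF.
Qed.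

Lemma lebesgue_null_bigcup (E : nat -> set (D -> R)) :
  (forall n, lebesgue_null (E n)) -> lebesgue_null (\bigcup_n E n).
Proof.
move=> hE e e0; apply: (covers_bigcup (c := fun n => e * (1 / 2) ^+ n.+1)).
  by move=> n; apply: hE; rewrite mulr_gt0// exprn_gt0//; lra.
by move=> m; rewrite -mulr_sumr ler_piMr ?(ltW e0)// sum_half_powers_le1.
Qed.

(** Both bounds refer to the cube of half side [N]; boundedness is included so that the class is
    closed under products. *)
Definition bounded_lipschitz (N : R) (f : (D -> R) -> R) :=
  exists2 C, 0 <= C & forall x y h, (forall d, `|x d| <= N) ->
    (forall d, `|y d| <= N) -> 0 <= h -> (forall d, `|x d - y d| <= h) ->
    `|f x| <= C /\ `|f x - f y| <= C * h.

Lemma bounded_lipschitz_cst N c : bounded_lipschitz N (cst c).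
Proof.
by exists `|c| => // x y h *; rewrite subrr normr0 mulr_ge0.
Qed.

Lemma bounded_lipschitz_proj N d : 0 <= N -> bounded_lipschitz N (fun x => x d).
Proof.
move=> N0; exists (N + 1); first by lra.
move=> x y h xN yN h0 xy; split; first by have := xN d; lra.
have := xy d; have := mulr_ge0 N0 h0; lra.
Qed.

Lemma bounded_lipschitzD N f g : bounded_lipschitz N f ->
  bounded_lipschitz N g -> bounded_lipschitz N (fun x => f x + g x).
Proof.
move=> [C C0 hf] [B B0 hg]; exists (C + B); first exact: addr_ge0.
move=> x y h xN yN h0 xy; have [f1 f2] := hf _ _ _ xN yN h0 xy.
have [g1 g2] := hg _ _ _ xN yN h0 xy; split.
  by apply: le_trans (ler_normD _ _) _; exact: lerD.
rewrite opprD addrACA mulrDl; apply: le_trans (ler_normD _ _) _; exact: lerD.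
Qed.

Lemma bounded_lipschitzM N f g : bounded_lipschitz N f ->
  bounded_lipschitz N g -> bounded_lipschitz N (fun x => f x * g x).
Proof.
move=> [C C0 hf] [B B0 hg]; exists (2 * (C * B)); first by rewrite !mulr_ge0.
move=> x y h xN yN h0 xy; have [f1 f2] := hf _ _ _ xN yN h0 xy.
have [g1 g2] := hg _ _ _ xN yN h0 xy.
have yy d : `|y d - y d| <= h by rewrite subrr normr0.
have [f3 _] := hf y y h yN yN h0 yy.
have CB := mulr_ge0 C0 B0; split.
  by rewrite normrM; have := ler_pM (normr_ge0 _) (normr_ge0 _) f1 g1; lra.
have -> : f x * g x - f y * g y = (f x - f y) * g x + f y * (g x - g y) by ring.
apply: le_trans (ler_normD _ _) _; rewrite !normrM.
have := ler_pM (normr_ge0 _) (normr_ge0 _) f2 g1.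
have := ler_pM (normr_ge0 _) (normr_ge0 _) f3 g2; lra.
Qed.

Lemma bounded_lipschitz_sum N (I : finType) (f : I -> (D -> R) -> R) :
  (forall i, bounded_lipschitz N (f i)) ->
  bounded_lipschitz N (fun x => \sum_i f i x).
Proof.
move=> hf; elim: (index_enum I) => [|i s IH].
  under eq_fun do rewrite big_nil; exact: bounded_lipschitz_cst.
under eq_fun do rewrite big_cons; exact: bounded_lipschitzD.
Qed.

Lemma bounded_lipschitz_mulmx N m n p (A : (D -> R) -> 'M[R]_(m, n))
    (B : (D -> R) -> 'M[R]_(n, p)) :
  (forall i j, bounded_lipschitz N (fun x => A x i j)) ->
  (forall i j, bounded_lipschitz N (fun x => B x i j)) ->
  forall i j, bounded_lipschitz N (fun x => (A x *m B x) i j).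
Proof.
move=> hA hB i j; under eq_fun do rewrite mxE.
by apply: bounded_lipschitz_sum => l; exact: bounded_lipschitzM.
Qed.

End BoxCoverings.

(** * Almost every parameter is nonresonant *)

Section Parametrization.
Variables (R : realType) (k : nat) (sing : {set 'I_k.+1}).
Local Notation D := ('I_k.+1 * 'I_4)%type.
Implicit Types (x y : D -> R) (w : seq 'I_k.+1).

Definition ucol x s : 'cV[R]_2 := \col_(r < 2) x (s, inord r).
Definition vrow x s : 'rV[R]_2 := \row_(c < 2) x (s, inord (2 + c)).

Lemma param_sing x s : s \in sing -> param sing x s = ucol x s *m vrow x s.
Proof.
by move=> ss; apply/matrixP => i j; rewrite /param ss !mxE big_ord1 !mxE.
Qed.

Lemma param_entry_lipschitz N i r c : 0 <= N ->
  bounded_lipschitz N (fun x : D -> R => param sing x i r c).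
Proof.
move=> N0; rewrite /param; case: (i \in sing); under eq_fun => x do rewrite mxE.
  by apply: bounded_lipschitzM; exact: bounded_lipschitz_proj.
exact: bounded_lipschitz_proj.
Qed.

Lemma wmat_entry_lipschitz N w r c : 0 <= N ->
  bounded_lipschitz N (fun x : D -> R => wmat (param sing x) w r c).
Proof.
move=> N0; elim: w r c => [|i w IH] r c /=.
  by under eq_fun => x do rewrite mxE; exact: bounded_lipschitz_cst.
apply: bounded_lipschitz_mulmx => // r' c'.
exact: param_entry_lipschitz.
Qed.

Definition pairing s s' w x : R :=
  (vrow x s' *m wmat (param sing x) w *m ucol x s) 0 0.

Lemma pairing_lipschitz N s s' w : 0 <= N ->
  bounded_lipschitz N (pairing s s' w).
Proof.
move=> N0; apply: bounded_lipschitz_mulmx => i j; last first.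
  by under eq_fun => x do rewrite mxE; exact: bounded_lipschitz_proj.
apply: bounded_lipschitz_mulmx => {}i {}j; last exact: wmat_entry_lipschitz.
by under eq_fun => x do rewrite mxE; exact: bounded_lipschitz_proj.
Qed.

(** For [w] without singular letters and singular [s'], this is the partial derivative of
    [pairing s s' w] in the coordinate [c] of the row of [s']. *)
Definition slope s (c : 'I_2) w x : R := (wmat (param sing x) w *m ucol x s) c 0.

Lemma eq_wmat (A B : 'I_k.+1 -> 'M[R]_2) w :
  {in w, forall i, A i = B i} -> wmat A w = wmat B w.
Proof.
elim: w => //= i w IH h; rewrite h ?mem_head// IH// => j jw.
by rewrite h// inE jw orbT.
Qed.

(** The matrices along [w] do not involve the parameters of the singular letter [s'], and the
    altered coordinate belongs to the [v] part, so [u] is unchanged even when s = s'. *)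
Lemma pairing_update s s' (c : 'I_2) w x t : s' \in sing -> ~~ has (mem sing) w ->
  let d0 := (s', inord (2 + (c : nat))) in
  pairing s s' w (fun d => if d == d0 then t else x d) - pairing s s' w x =
  (t - x d0) * slope s c w x.
Proof.
move=> ss nw /=; set x' := fun d => _.
have lt4 (a : 'I_2) : (2 + a < 4)%N by case: a => -[|[]].
have lt2 (a : 'I_2) : (a < 4)%N by case: a => -[|[]].
have eA : wmat (param sing x') w = wmat (param sing x) w.
  apply: eq_wmat => i iw; have ni : i \notin sing.
    by apply: contra nw => si; apply/hasP; exists i.
  rewrite /param (negPf ni); apply/matrixP => a b; rewrite !mxE /x' xpair_eqE.
  by case: eqP => // e; move: ni; rewrite e ss.
have eu : ucol x' s = ucol x s.
  apply/matrixP => a b; rewrite !mxE /x' xpair_eqE -[inord a == _]val_eqE /= !inordK//.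
  rewrite (_ : (_ == _ :> nat) = false) ?andbF//; apply/ltn_eqF.
  by rewrite ltn_addr.
rewrite /pairing /slope -!mulmxA eA eu.
set z := _ *m ucol x s.
have -> : (vrow x' s' *m z) 0 0 - (vrow x s' *m z) 0 0 =
    ((vrow x' s' - vrow x s') *m z) 0 0 by rewrite mulmxBl !mxE.
rewrite mxE (bigD1 c)//= big1 ?addr0 => [|c' cc].
  by rewrite !mxE /x' eqxx.
rewrite !mxE /x' xpair_eqE eqxx /= -val_eqE /= !inordK//.
by rewrite eqn_add2l val_eqE (negPf cc) subrr mul0r.
Qed.

(* The pairing is affine in the coordinate c of v_{s'}, with slope at least g in
   absolute value, so the resonant set is a slab of width O(e / g). *)
Lemma resonant_slab_covers (N g e : R) s s' (c : 'I_2) w : 1 <= N -> 0 < g -> 0 < e ->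
  s' \in sing -> ~~ has (mem sing) w ->
  covers [set x : D -> R | [/\ forall d, `|x d| <= N,
      `|pairing s s' w x| < e & g <= `|slope s c w x|] ]
    (6 * e / g * (2 * N) ^+ #|{: D}|).
Proof.
move=> N1 g0 e0 ss nw; have N0 : 0 <= N by lra.
have [C C0 hC] := pairing_lipschitz s s' w N0.
pose d0 : D := (s', inord (2 + (c : nat))).
have r0 : 0 <= 3 * e / g by rewrite divr_ge0//; lra.
have h0 : 0 < e / (C + 1) by rewrite divr_gt0//; lra.
have Np : 0 < N by lra.
apply: covers_sub (@slab_covers R _ (ord0, ord0) d0 N _ _ _ Np r0 h0 _ _).
- exact: subset_refl.
- rewrite (bigD1 d0)//= eqxx.
  rewrite (eq_bigr (fun=> 2 * N)) => [|d /negPf ->//].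
  rewrite prodr_const (_ : 2 * (3 * e / g) = 6 * e / g); last by ring.
  rewrite ler_wpM2l ?divr_ge0 ?mulr_ge0 ?(ltW e0) ?(ltW g0)//.
  by apply: ler_weXn2l; [lra | apply: max_card].
- by move=> x [].
move=> x y [xN xe xg] [yN ye yg] xy.
(* [x'] is [x] with coordinate [d0] taken from [y]. It is within the mesh of [y], so these pairings
   differ by at most [e]; from [x] it differs only at [d0], which isolates the slope. *)
have := pairing_update s c x (y d0) ss nw; rewrite -/d0 /=.
set x' := fun d => _ => e1.
have x'N d : `|x' d| <= N by rewrite /x'; case: ifP.
have x'y d : `|x' d - y d| <= e / (C + 1).
  rewrite /x'; case: ifPn => [/eqP ->|/xy//].
  by rewrite subrr normr0 ltW.
have [_ e2] := hC x' y _ x'N yN (ltW h0) x'y.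
have e3 : C * (e / (C + 1)) <= e.
  by rewrite mulrCA ler_piMr// ?ltW// ltr_pdivrMr; lra.
rewrite ler_pdivlMr//; apply: (@le_trans _ _ (`|x d0 - y d0| * `|slope s c w x|)).
  by rewrite ler_wpM2l.
rewrite -normrM -normrN -mulNr opprB -e1.
move: xe ye e2; rewrite ltr_norml ltr_norml !ler_norml => /andP[? ?] /andP[? ?] /andP[? ?].
apply/andP; split; lra.
Qed.

(** A single [tau] works outside a set of measure [eps]: the number of words and the inverse slopes
    grow exponentially with the length, and a small [tau] beats both in the sum of all slabs. *)
Lemma resonant_null (N : R) : 1 <= N -> lebesgue_null [set x : D -> R |
  [/\ forall d, `|x d| <= N,
     forall j, j \notin sing -> N^-1 <= `|\det (param sing x j)|,
     forall s, s \in sing -> N^-1 <= l1 (ucol x s) &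
     ~ nonresonant (param sing x) sing (ucol x) (vrow x)] ].
Proof.
move=> N1 eps eps0.
have Np : 0 < N by lra.
(* Invertible letters here have norm at most 4N and determinant at least 1/N in absolute value, so
   each loses a factor at most 4 (4N) N. *)
pose kap : R := 16 * N ^+ 2.
have kap1 : 1 <= kap by have : 1 <= N ^+ 2 by [rewrite exprn_ege1|]; rewrite /kap; lra.
pose V := (2 * N) ^+ #|{: D}|.
have V0 : 0 < V by rewrite exprn_gt0//; lra.
pose q : R := k.+1%:R.
have q0 : 0 < q by [].
(* Length [l] gives [2 * q ^+ 2 * q ^+ l] index tuples, whose slab bounds add up to
   [tau * B * (tau * kap * q) ^+ l / 2]; [tau] is chosen to make this at most eps / 2^(l+1). *)
pose B := 48 * V * N * q ^+ 2.
have B0 : 0 < B.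
  by rewrite /B; apply: mulr_gt0; [apply: mulr_gt0; [apply: mulr_gt0|]|exact: exprn_gt0].
pose tau := Num.min 1 (Num.min (2 * kap * q)^-1 (eps / B)).
have kap0 : 0 < kap by lra.
have kq0 : 0 < 2 * kap * q by rewrite !mulr_gt0.
have tau0 : 0 < tau by rewrite !lt_min ltr01 invr_gt0 kq0 divr_gt0.
have tau1 : tau <= 1 by rewrite ge_min lexx.
have tau2 : tau * kap * q <= 1 / 2.
  have : tau <= (2 * kap * q)^-1 by rewrite !ge_min lexx orbT.
  by rewrite -(ler_pM2r kq0) mulVf ?gt_eqF//; lra.
have tau3 : tau * B <= eps by rewrite -ler_pdivlMr// !ge_min lexx !orbT.
pose I l := ('I_k.+1 * 'I_k.+1 * 'I_2 * l.-tuple 'I_k.+1)%type.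
pose g l : R := (2 * N * kap ^+ l)^-1.
have kl0 l : 0 < kap ^+ l by rewrite exprn_gt0; lra.
have g0 l : 0 < g l by rewrite invr_gt0 mulr_gt0 ?kl0 ?mulr_gt0.
pose F l (i : I l) : set (D -> R) := [set x : D -> R |
  [/\ i.1.1.2 \in sing, ~~ has (mem sing) i.2 & [/\ forall d, `|x d| <= N,
      `|pairing i.1.1.1 i.1.1.2 i.2 x| < tau ^+ l.+1 &
      g l <= `|slope i.1.1.1 i.1.2 i.2 x|] ] ].
have Fc l (i : I l) : covers (F l i) (6 * tau ^+ l.+1 / g l * V).
  have tl : 0 < tau ^+ l.+1 by rewrite exprn_gt0.
  have [h|h] := pselect (i.1.1.2 \in sing /\ ~~ has (mem sing) i.2); last first.
    have c0 : 0 <= 6 * tau ^+ l.+1 / g l * V.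
      by rewrite mulr_ge0 ?divr_ge0 ?mulr_ge0 ?(ltW (g0 l)) ?(ltW tl) ?(ltW V0).
    apply: covers_sub (covers_set0 (ord0, ord0) c0) => //.
    by move=> x [h1 h2]; case: h.
  have [h1 h2] := h.
  apply: covers_sub (@resonant_slab_covers N (g l) (tau ^+ l.+1) i.1.1.1 i.1.1.2
      i.1.2 i.2 N1 (g0 l) tl h1 h2) => //.
  by move=> x [].
have := covers_bigcup (ord0, ord0) (fun l => covers_fin (ord0, ord0) (Fc l)).
move=> /(_ eps) H; apply: covers_sub (H _) => //; last first.
  move=> m; apply: (@le_trans _ _ (\sum_(l < m) eps * (1 / 2) ^+ l.+1)); last first.
    by rewrite -mulr_sumr ler_piMr ?(ltW eps0)// sum_half_powers_le1.
  apply: ler_sum => l _; rewrite sumr_const -[leLHS]mulr_natr.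
  rewrite !card_prod !card_ord card_tuple card_ord !natrM natrX -/q.
  rewrite /g invrK.
  have -> : 6 * tau ^+ l.+1 * (2 * N * kap ^+ l) * V * (q * q * 2 * q ^+ l) =
     (tau * B) * (tau * kap * q) ^+ l / 2.
    by rewrite /B !exprMn exprS; field.
  have tkq0 : 0 <= tau * kap * q by rewrite !mulr_ge0// ltW.
  have hA : (tau * kap * q) ^+ l <= (1 / 2) ^+ l.
    by rewrite lerXn2r ?nnegrE//; lra.
  have tB0 : 0 <= tau * B by rewrite mulr_ge0// ltW.
  have := ler_pM tB0 (exprn_ge0 l tkq0) tau3 hA.
  by rewrite exprSr; lra.
move=> x [xN xdet xu nr].
have [s [s' [w [ss ss' nw hw]]]] : exists s s' w, [/\ s \in sing, s' \in sing,
    ~~ has (mem sing) w & `|pairing s s' w x| < tau ^+ (size w).+1].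
  apply: contrapT => h; apply: nr; exists tau; first by rewrite tau0.
  move=> s s' w ss ss' nw; rewrite leNgt; apply/negP => lt.
  by apply: h; exists s, s', w.
pose l := size w.
have zl : l1 (ucol x s) <= kap ^+ l * l1 (wmat (param sing x) w *m ucol x s).
  apply: (@l1_none_l R k (param sing x) sing) => //; first by lra.
  move=> j nj m M; have dj := xdet j nj.
  have lj : l1 (param sing x j) <= 4 * N.
    have hE r c : `|param sing x j r c| <= N by rewrite /param (negPf nj) mxE.
    rewrite /l1 !big_ord_recl !big_ord0.
    have := hE ord0 ord0; have := hE ord0 (lift ord0 ord0).
    have := hE (lift ord0 ord0) ord0; have := hE (lift ord0 ord0) (lift ord0 ord0).
    lra.
  have := l1_det_mul M (param sing x j) => h.
  have h1 : N^-1 * l1 M <= 4 * (4 * N) * l1 (param sing x j *m M).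
    apply: (@le_trans _ _ (`|\det (param sing x j)| * l1 M)).
      by rewrite ler_wpM2r ?l1_ge0.
    by apply: le_trans h _; rewrite ler_wpM2r ?l1_ge0// ler_wpM2l.
  move: h1; rewrite mulrC ler_pdivrMr// => /le_trans; apply.
  by rewrite le_eqVlt; apply/orP; left; apply/eqP; rewrite /kap; ring.
(* One of the two entries carries at least half of the norm, whence the 2 in [g]. *)
have [c hc] : exists c, g l <= `|slope s c w x|.
  apply: contrapT => h.
  have lt c : `|slope s c w x| < g l.
    by rewrite ltNge; apply/negP => hc; apply: h; exists c.
  have : l1 (wmat (param sing x) w *m ucol x s) < g l + g l.
    rewrite /l1 !big_ord_recl !big_ord0 !addr0.
    by rewrite ltrD//; exact: lt.
  apply/negP; rewrite -leNgt -(ler_pM2l (kl0 l)); apply: le_trans zl.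
  apply: le_trans (xu s ss).
  rewrite /g invfM le_eqVlt; apply/orP; left; apply/eqP.
  by field; rewrite !gt_eqF.
by exists l => //; exists (s, s', c, in_tuple w).
Qed.

(** Exhaustion by countably many [N]: some [N] bounds all coordinates and the inverses of the
    determinants and of the norms of the [u], which are nonzero by rank one. *)
Lemma nonresonant_ae : lebesgue_null [set x : D -> R | inM sing (param sing x) /\
  ~ nonresonant (param sing x) sing (ucol x) (vrow x)].
Proof.
move=> e e0.
have := lebesgue_null_bigcup (ord0, ord0) (fun n : nat =>
   @resonant_null n.+1%:R (ltac:(by rewrite ler1n))).
move=> /(_ e e0); apply: (covers_sub _ (lexx e)) => x [[xs xi] nr].
pose S := \sum_d `|x d| + \sum_(j | j \notin sing) `|\det (param sing x j)|^-1 +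
  \sum_(s in sing) (l1 (ucol x s))^-1.
have S1 : 0 <= \sum_d `|x d| by apply: sumr_ge0.
have S2 : 0 <= \sum_(j | j \notin sing) `|\det (param sing x j)|^-1.
  by apply: sumr_ge0 => j _; rewrite invr_ge0.
have S3 : 0 <= \sum_(s in sing) (l1 (ucol x s))^-1.
  by apply: sumr_ge0 => j _; rewrite invr_ge0 l1_ge0.
have [n hn] : exists n, S <= n.+1%:R.
  exists (Num.bound S); apply: le_trans (ltW (archi_boundP _)) _.
    by rewrite !addr_ge0.
  by rewrite ler_nat.
exists n => //; split=> //.
- move=> d; apply: le_trans hn; apply: (@le_trans _ _ (\sum_d `|x d|)).
    by rewrite (bigD1 d)//= lerDl sumr_ge0.
  by rewrite /S -addrA lerDl addr_ge0.
- move=> j nj; have d0 : 0 < `|\det (param sing x j)| by rewrite normr_gt0 gt_eqF ?xi.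
  rewrite -[leRHS]invrK lef_pV2 ?posrE ?invr_gt0//; apply: le_trans hn.
  apply: (@le_trans _ _ (\sum_(j | j \notin sing) `|\det (param sing x j)|^-1)).
    by rewrite [leRHS](bigD1 j)//= lerDl sumr_ge0// => i _; rewrite invr_ge0.
  by rewrite /S; lra.
- move=> s ss; have u0 : 0 < l1 (ucol x s).
    rewrite l1_gt0//; apply/eqP => u0; have := xs s ss.
    by rewrite param_sing// u0 mul0mx mxrank0.
  rewrite -[leRHS]invrK lef_pV2 ?posrE ?invr_gt0//; apply: le_trans hn.
  apply: (@le_trans _ _ (\sum_(s in sing) (l1 (ucol x s))^-1)).
    by rewrite [leRHS](bigD1 s)//= lerDl sumr_ge0// => i _; rewrite invr_ge0 l1_ge0.
  by rewrite /S; lra.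
Qed.

End Parametrization.

(** * From the Markov measure to expectations over words *)

Section OperatorNorm.
Variable R : realType.
Implicit Types (v : 'cV[R]_2) (M : 'M[R]_2).

Lemma vnorm_entry v i : `|v i 0| <= vnorm v.
Proof.
rewrite /vnorm -sqrtr_sqr ler_sqrt; last by apply: sumr_ge0 => j _; rewrite sqr_ge0.
by rewrite [leRHS](bigD1 i)//= lerDl; apply: sumr_ge0 => j _; rewrite sqr_ge0.
Qed.

Lemma vnorm_le_l1 v : vnorm v <= l1 v.
Proof.
rewrite -[l1 v]ger0_norm ?l1_ge0// -sqrtr_sqr ler_sqrt ?sqr_ge0//.
rewrite /l1 !big_ord_recl !big_ord0 !addr0.
rewrite -[v ord0 0 ^+ 2]real_normK ?num_real// -[v (lift _ _) 0 ^+ 2]real_normK ?num_real//.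
rewrite sqrrD; have := mulr_ge0 (normr_ge0 (v ord0 0)) (normr_ge0 (v (lift ord0 ord0) 0)).
lra.
Qed.

Lemma vnorm_mul_le M v : vnorm v = 1 -> vnorm (M *m v) <= l1 M.
Proof.
move=> v1; apply: le_trans (vnorm_le_l1 _) _; apply: ler_sum => i _.
rewrite big_ord1 mxE; apply: le_trans (ler_norm_sum _ _ _) _.
by apply: ler_sum => j _; rewrite normrM ler_piMr// -v1 vnorm_entry.
Qed.

Lemma vnorm_delta j : vnorm (delta_mx j 0 : 'cV[R]_2) = 1.
Proof.
rewrite /vnorm (bigD1 j)//= big1 => [|i ij]; last by rewrite mxE (negPf ij) expr0n.
by rewrite mxE !eqxx expr1n addr0 sqrtr1.
Qed.

Lemma opnorm_le_l1 M : opnorm M <= l1 M.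
Proof.
apply: ge_sup; first by exists (vnorm (M *m delta_mx 0 0)), (delta_mx 0 0) => //=;
  exact: vnorm_delta.
by move=> _ [v /= v1 <-]; exact: vnorm_mul_le.
Qed.

Lemma l1_le_opnorm M : l1 M <= 4 * opnorm M.
Proof.
have h i j : `|M i j| <= opnorm M.
  have -> : M i j = (M *m (delta_mx j 0 : 'cV[R]_2)) i 0.
    rewrite mxE (bigD1 j)//= big1 ?addr0 => [|l lj].
      by rewrite mxE !eqxx mulr1.
    by rewrite mxE (negPf lj) mulr0.
  apply: le_trans (vnorm_entry _ _) _; apply: ub_le_sup.
    by exists (l1 M) => _ [v /= v1 <-]; exact: vnorm_mul_le.
  by exists (delta_mx j 0) => //=; exact: vnorm_delta.
rewrite /l1 !big_ord_recl !big_ord0.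
have := h ord0 ord0; have := h ord0 (lift ord0 ord0).
have := h (lift ord0 ord0) ord0; have := h (lift ord0 ord0) (lift ord0 ord0).
lra.
Qed.

End OperatorNorm.

Lemma measure_fin_partition d (T : measurableType d) (R : realType)
    (mu : {measure set T -> \bar R}) (I : finType) (E : I -> set T) :
  (forall i, measurable (E i)) -> trivIset setT E ->
  mu (\bigcup_i E i) = (\sum_i mu (E i))%E.
Proof.
move=> mE tE; have fI : finite_set [set: I] by exact: finite_finset.
rewrite (measure_fin_bigcup mu fI tE) => [|i _]; last exact: mE.
rewrite (fsbig_finite _ _ fI); apply: perm_big; apply: uniq_perm;
  rewrite ?index_enum_uniq ?fset_uniq// => i.
by rewrite in_fset_set// mem_index_enum in_setT.
Qed.

(** * Probabilities of events that depend on finitely many letters *)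

Section MarkovLaw.
Variables (R : realType) (k : nat) (mu : probability (X k) R).
Variables (P : 'M[R]_k.+1) (q : 'I_k.+1 -> R).
Hypothesis P_ge0 : forall i j, 0 <= P i j.
Hypothesis P_sum1 : forall j, \sum_i P i j = 1.
Hypothesis q_ge0 : forall i, 0 <= q i.
Hypothesis q_sum1 : \sum_i q i = 1.
Hypothesis mu_cylinder : forall m n w, mu (@cylinder k m n w) =
  (q (w ord0) * \prod_(l < n) P (w (lift ord0 l)) (w (widen_ord (leqnSn n) l)))%:E.

(** The letter at [r] is the state from which the chain runs, so the word starts at r + 1; for r = 0
    these are the letters read by [cocycle]. *)
Definition word (om : X k) (r n : nat) : seq 'I_k.+1 :=
  [seq (om : int -> 'I_k.+1) (r + i.+1)%N%:Z | i <- iota 0 n].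

Definition prefix_event (r : nat) (w : nat -> 'I_k.+1) n (G : pred (seq 'I_k.+1)) :
    set (X k) :=
  [set om : X k | (forall l, (l <= r)%N -> (om : int -> 'I_k.+1) l%:Z = w l) /\
    G (word om r n)].

Lemma measurable_cylinder m n w : measurable (@cylinder k m n w : set (X k)).
Proof. by apply: sub_sigma_algebra; exists m, n, w. Qed.

(** Induction on [n]: the event is split by the letter at r + 1, which moves from the word into the
    prescribed prefix, until a cylinder or the empty set remains. *)
Lemma prefix_eventP r w n (G : pred (seq 'I_k.+1)) :
  measurable (prefix_event r w n G) /\
  mu (prefix_event r w n G) =
  (q (w 0%N) * \prod_(l < r) P (w l.+1) (w l) *
     Ex P n (w r) (fun s => (G s)%:R))%:E.
Proof.
elim: n r w G => [|n IH] r w G.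
  have -> : prefix_event r w 0 G =
      if G [::] then @cylinder k 0 r (fun l : 'I_r.+1 => w l) else set0.
    rewrite /prefix_event /=; case: (G [::]); apply/seteqP; split => om //=.
    - by move=> [h _] l; rewrite add0r h// -ltnS.
    - by move=> h; split => // l lr; have := h (Ordinal (lr : (l < r.+1)%N)); rewrite add0r.
    - by case.
  rewrite /=; case: (G [::]); last by rewrite measure0 mulr0.
  by split; [exact: measurable_cylinder | rewrite mu_cylinder mulr1].
pose w' i l := if l == r.+1 then i else w l.
have -> : prefix_event r w n.+1 G =
    \bigcup_i prefix_event r.+1 (w' i) n (fun s => G (i :: s)).
  apply/seteqP; split => om /=.
    move=> [h g]; exists (om r.+1%:Z) => //; split.
      move=> l; rewrite /w'; case: eqP => [->//|/eqP lr].
      by rewrite leq_eqVlt (negPf lr) /= ltnS => /h.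
    move: g; rewrite /word /= addn1 (iotaDl 1 0 n) -map_comp.
    by under eq_map do rewrite /= add1n -addSnnS.
  move=> [i _ [h g]]; split.
    by move=> l lr; rewrite h ?(leq_trans lr)// /w' ltn_eqF.
  have := h r.+1 (leqnn _); rewrite /w' eqxx => hi.
  move: g; rewrite /word /= addn1 hi (iotaDl 1 0 n) -map_comp.
  by under [in X in _ -> X]eq_map do rewrite /= add1n -addSnnS.
have mE i : measurable (prefix_event r.+1 (w' i) n (fun s => G (i :: s))).
  by have [] := IH r.+1 (w' i) (fun s => G (i :: s)).
split; first by apply: fin_bigcup_measurable => // ; exact: finite_finset.
rewrite measure_fin_partition//; last first.
  move=> i j _ _ [om [[hi _] [hj _]]].
  by have := hi _ (leqnn _); rewrite (hj _ (leqnn _)) /w' eqxx.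
rewrite (eq_bigr (fun i => (q (w 0%N) * \prod_(l < r) P (w l.+1) (w l) *
    (P i (w r) * Ex P n i (fun s => (G (i :: s))%:R)))%:E)); last first.
  move=> i _; apply: etrans (proj2 (IH r.+1 (w' i) (fun s => G (i :: s)))) _.
  have e l : (l <= r)%N -> w' i l = w l by rewrite /w' => lr; rewrite ltn_eqF.
  have e1 : w' i r.+1 = i by rewrite /w' eqxx.
  rewrite big_ord_recr /= e1 !e// -!mulrA; congr (q _ * (_ * _))%:E.
  by apply: eq_bigr => l _; rewrite !e// ltnW.
by rewrite sumEFin -mulr_sumr.
Qed.

Lemma word_event_le n (G : pred (seq 'I_k.+1)) (c : R) :
  (forall j, Ex P n j (fun s => (G s)%:R) <= c) ->
  measurable [set om : X k | G (word om 0 n)] /\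
  (mu [set om : X k | G (word om 0 n)] <= c%:E)%E.
Proof.
move=> hc.
have -> : [set om : X k | G (word om 0 n)] =
    \bigcup_j prefix_event 0 (fun=> j) n G.
  apply/seteqP; split => om /= => [g|[j _ []//]].
  by exists (om 0%Z) => //; split => // l; rewrite leqn0 => /eqP ->.
have h j := prefix_eventP 0 (fun=> j) n G.
split; first by apply: fin_bigcup_measurable => [|j _]; [exact: finite_finset|have [] := h j].
have mE j : measurable (prefix_event 0 (fun=> j) n G) by have [] := h j.
rewrite measure_fin_partition//; last first.
  by move=> i j _ _ [om [[hi _] [hj _]]]; rewrite -(hi 0%N)// -(hj 0%N).
rewrite (eq_bigr (fun j => (q j * Ex P n j (fun s => (G s)%:R))%:E)); last first.
  by move=> j _; apply: etrans (proj2 (h j)) _; rewrite big_ord0 mulr1.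
rewrite sumEFin lee_fin -[leRHS]mul1r -[X in X * c]q_sum1 mulr_suml.
by apply: ler_sum => j _; rewrite ler_wpM2l.
Qed.

End MarkovLaw.

(** * Deviations of the Lyapunov exponent *)

Lemma summable_lim_sup_null d (T : measurableType d) (R : realType)
    (mu : {measure set T -> \bar R}) (F : (set T)^nat) (a z : R) :
  0 <= a -> 0 <= z < 1 -> (forall n, measurable (F n)) ->
  (forall n, (mu (F n) <= (a * z ^+ n)%:E)%E) -> mu (lim_sup_set F) = 0%E.
Proof.
move=> a0 /andP[z0 z1] mF muF; apply: lim_sup_set_cvg0 => //.
apply: (@le_lt_trans _ _ (a / (1 - z))%:E); last exact: ltry.
apply: lime_le; first by apply: is_cvg_nneseries => n _ _; exact: measure_ge0.
apply: nearW => n; apply: (@le_trans _ _ (\sum_(0 <= i < n) (a * z ^+ i)%:E)%E).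
  by apply: lee_sum => i _; exact: muF.
rewrite sumEFin lee_fin -mulr_sumr ler_wpM2l// big_mkord.
rewrite -[leRHS]mul1r ler_pdivlMr ?subr_gt0//.
suff -> : (\sum_(i < n) z ^+ i) * (1 - z) = 1 - z ^+ n by rewrite gerBl exprn_ge0.
elim: n => [|n IH]; first by rewrite big_ord0 mul0r expr0 subrr.
by rewrite big_ord_recr /= mulrDl IH exprSr; ring.
Qed.

Section LyapunovDeviation.
Variables (R : realType) (k : nat) (mu : probability (X k) R).
Variables (P : 'M[R]_k.+1) (q : 'I_k.+1 -> R) (m0 : nat).
Hypothesis P_ge0 : forall i j, 0 <= P i j.
Hypothesis P_sum1 : forall j, \sum_i P i j = 1.
Hypothesis m0_gt0 : (0 < m0)%N.
Hypothesis P_prim : forall i j, 0 < mxpow P m0 i j.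
Hypothesis q_ge0 : forall i, 0 <= q i.
Hypothesis q_sum1 : \sum_i q i = 1.
Hypothesis mu_cylinder : forall m n w, mu (@cylinder k m n w) =
  (q (w ord0) * \prod_(l < n) P (w (lift ord0 l)) (w (widen_ord (leqnSn n) l)))%:E.

Variables (A : 'I_k.+1 -> 'M[R]_2) (sing : {set 'I_k.+1}).
Variables (u : 'I_k.+1 -> 'cV[R]_2) (v : 'I_k.+1 -> 'rV[R]_2).
Hypothesis A_sing : forall s, s \in sing -> A s = u s *m v s.
Hypothesis sing_ne0 : exists s, s \in sing.
Hypothesis A_inv : forall j, j \notin sing -> \det (A j) != 0.
Hypothesis NR : nonresonant A sing u v.

Let wmat_n0 := wmat_neq0 A_sing sing_ne0 NR.

Lemma opnorm_wmat_gt0 w : 0 < opnorm (wmat A w).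
Proof.
have := l1_le_opnorm (wmat A w); have := l1_gt0 (wmat_n0 w); lra.
Qed.

Lemma lyap_nE om n :
  lyap_n A om n = (n%:R^-1 * ln (opnorm (wmat A (word om 0 n))))%:E.
Proof. by rewrite /lyap_n cocycle_wmat /elog gt_eqF// opnorm_wmat_gt0. Qed.

Lemma ln_opnorm_wmat w : `|ln (opnorm (wmat A w)) - logN A w| <= ln 4.
Proof.
have o0 := opnorm_wmat_gt0 w; have l0 := l1_gt0 (wmat_n0 w).
have h1 : ln (opnorm (wmat A w)) <= logN A w.
  by rewrite ler_ln ?posrE// opnorm_le_l1.
have : logN A w <= ln (4 * opnorm (wmat A w)).
  by rewrite ler_ln ?posrE ?mulr_gt0// l1_le_opnorm.
rewrite lnM ?posrE// => h2.
have : 0 <= ln 4 :> R by rewrite ln_ge0// ler1n.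
by rewrite ler_norml => *; apply/andP; split; lra.
Qed.

Lemma exponential_deviation : exists L : R, forall eps : R, 0 < eps ->
  exists C t : R, [/\ 0 < C, 0 < t & forall n, (0 < n)%N ->
    measurable [set om : X k | (eps%:E < `| lyap_n A om n - L%:E |)%E] /\
    (mu [set om : X k | eps%:E < `| lyap_n A om n - L%:E |] <=
       (C * expR (- t * n%:R))%:E)%E].
Proof.
have [T [K [sT TS SK TK ST]]] := exists_minorant A_sing sing_ne0 A_inv NR.
have sS : subadd (logN A) := logN_cat_le A_sing sing_ne0 NR.
have K0 : 0 <= K by have := SK [::]; rewrite mulr1; apply: le_trans.
have dST (e : R) : 0 < e -> exists n0, forall n j, (n0 <= n)%N ->
    Ex P n j (fun w => logN A w - T w) <= e * n%:R.
  move=> e0; have e1 : 0 < e / 2 / (K + 1) by rewrite !divr_gt0//; lra.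
  have [n0 h0] := Ex_find_small P_ge0 P_sum1 P_prim sing_ne0 m0_gt0 e1.
  exists (n0 + Num.bound (K / (e / 2)))%N => n j hn.
  have Kn : K <= e / 2 * n%:R.
    rewrite [leRHS]mulrC -ler_pdivrMr ?divr_gt0//.
    apply: le_trans (ltW (archi_boundP _)) _; first by rewrite !divr_ge0// ltW.
    by rewrite ler_nat (leq_trans _ hn)// leq_addl.
  apply: (@le_trans _ _ (Ex P n j (fun w =>
      K + K * (find (mem sing) w + find (mem sing) (rev w))%N%:R))).
    apply: (le_Ex P_ge0) => w _; apply: le_trans (ST w) _.
    by rewrite -natr1 mulrDr mulr1 addrC.
  rewrite ExD Ex_cst// ExZ.
  have := h0 n j (leq_trans (leq_addr _ _) hn) => /(ler_wpM2l K0) h.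
  have : K * (e / 2 / (K + 1) * n%:R) <= e / 2 * n%:R.
    rewrite mulrA ler_wpM2r// mulrCA ler_piMr//; first by lra.
    by rewrite ler_pdivrMr; lra.
  lra.
(* The slack [ln 4] bounds the gap between the logarithms of the operator norm and of the entrywise
   norm. *)
have [L hL] := sandwich_deviation P_ge0 P_sum1 P_prim (ln 4) sS sT TS SK TK dST.
exists L => eps eps0; have [C [t [C0 t0 h]]] := hL eps eps0.
exists C, t; split => // n n0; have n0' : (0 : R) < n%:R by rewrite ltr0n.
pose G (w : seq 'I_k.+1) := eps < `|n%:R^-1 * ln (opnorm (wmat A w)) - L|.
have -> : [set om : X k | (eps%:E < `| lyap_n A om n - L%:E |)%E] =
    [set om : X k | G (word om 0 n)].
  by apply/seteqP; split => om /=; rewrite lyap_nE -EFinB abse_EFin lte_fin.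
apply: (word_event_le q_ge0 q_sum1 mu_cylinder (G := G)) => j.
apply: le_trans (h n j); apply: (le_Ex P_ge0) => w _.
case: (boolP (G w)) => // Gw.
suff -> : n%:R * eps - ln 4 < `|logN A w - n%:R * L| by [].
have e : n%:R * (n%:R^-1 * ln (opnorm (wmat A w)) - L) =
    ln (opnorm (wmat A w)) - n%:R * L.
  by rewrite mulrBr mulVKf ?gt_eqF.
have : n%:R * eps < `|ln (opnorm (wmat A w)) - n%:R * L|.
  by rewrite -e normrM gtr0_norm// ltr_pM2l.
have := ler_normD (ln (opnorm (wmat A w)) - logN A w) (logN A w - n%:R * L).
rewrite addrA subrK; have := ln_opnorm_wmat w; lra.
Qed.

Lemma lyapunov_deviation : exists L1 : R, is_L1 mu A L1%:E /\
  forall eps : R, 0 < eps -> exists C c0 : R, 0 < c0 /\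
    forall n : nat, (0 < n)%N ->
      (mu [set om : X k | eps%:E < `| lyap_n A om n - L1%:E |]
        <= (C * expR (- c0 * (n%:R `^ (3%:R^-1))))%:E)%E.
Proof.
have [L hL] := exponential_deviation; exists L; split; last first.
  move=> eps /hL[C [t [C0 t0 h]]]; exists C, t; split => // n n0.
  have [_ /le_trans] := h n n0; apply.
  (* For n >= 1 the cube root of n is at most n, so the exponential rate is stronger. *)
  rewrite lee_fin ler_pM2l// ler_expR !mulNr lerN2 ler_pM2l//.
  rewrite -[leRHS]powRr1//; apply: ler_powR; first by rewrite ler1n.
  by rewrite invf_le1// ler1n.
(* Convergence is tested on the tolerances 1/(p+1), giving countably many null sets; the index is
   shifted because the deviation bound starts at n = 1. *)
have ae p : \forall om \ae mu, exists N, forall n, (N <= n)%N ->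
    (`| lyap_n A om n.+1 - L%:E | <= (p.+1%:R^-1)%:E)%E.
  have [C [t [C0 t0 h]]] := hL (p.+1%:R^-1) ltac:(by rewrite invr_gt0).
  pose F n := [set om : X k | (p.+1%:R^-1%:E < `| lyap_n A om n.+1 - L%:E |)%E].
  have mF n : measurable (F n) by have [] := h n.+1 isT.
  exists (lim_sup_set F); split.
  - by apply: bigcap_measurable => // m _; exact: bigcup_measurable.
  - apply: (@summable_lim_sup_null _ _ _ _ _ (C * expR (- t)) (expR (- t))) => //.
    + by rewrite mulr_ge0 ?expR_ge0// ltW.
    + by rewrite expR_ge0 -[ltRHS]expR0 ltr_expR oppr_lt0.
    + move=> n; have [_ /le_trans] := h n.+1 isT; apply.
      rewrite lee_fin -mulrA -exprS -expRM_natr mulNr.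
      by rewrite le_refl.
  - move=> om /= nex N _; apply: contrapT => hN; apply: nex; exists N => n Nn.
    by rewrite leNgt; apply/negP => lt; apply: hN; exists n.
apply: filterS (ae_foralln ae) => om hom.
under eq_fun do rewrite lyap_nE.
apply: cvg_EFin; first exact: nearW.
apply/cvgrPdist_le => e e0.
have [p pe] : exists p, p.+1%:R^-1 <= e.
  exists (Num.bound e^-1); rewrite -[leRHS]invrK lef_pV2 ?posrE ?invr_gt0//.
  apply: le_trans (ltW (archi_boundP _)) _; first by rewrite invr_ge0 ltW.
  by rewrite ler_nat.
have [N hN] := hom p; apply: near_inftyS; exists N => // n /= Nn.
have := hN n Nn; rewrite lyap_nE -EFinB abse_EFin lee_fin distrC => /le_trans.
exact.
Qed.

End LyapunovDeviation.

Theorem theorem1p1 (R : realType) (k : nat) (sing : {set 'I_k.+1})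
  (sing_ne0 : exists i, i \in sing) (inv_ne0 : exists j, j \notin sing)
  (mu : probability (X k) R)
  (hmu : bernoulli_measure mu \/ markov_measure mu) :
  ae_M sing (fun A =>
    exists L1 : R, is_L1 mu A L1%:E /\
    forall eps : R, 0 < eps -> exists C c0 : R, 0 < c0 /\
      forall n : nat, (0 < n)%N ->
        (mu [set om : X k | eps%:E < `| lyap_n A om n - L1%:E |]
          <= (C * expR (- c0 * (n%:R `^ (3%:R^-1))))%:E)%E).

Proof.
have [P [q [m0 [P0 [P1 [Pp [q0 [q1 hc]]]]]]]] : exists (P : 'M[R]_k.+1) q m0,
    (forall i j, 0 <= P i j) /\ (forall j, \sum_i P i j = 1) /\
    (forall i j, 0 < mxpow P m0 i j) /\ (forall i, 0 <= q i) /\ \sum_i q i = 1 /\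
    forall m n w, mu (@cylinder k m n w) = (q (w ord0) *
      \prod_(l < n) P (w (lift ord0 l)) (w (widen_ord (leqnSn n) l)))%:E.
  case: hmu => [[p [p0 [p1 hp]]]|[P [q [P0 [P1 [[m Pm] [q0 [q1 [_ hc]]]]]]]]]; last first.
    by exists P, q, m.
  (* A Bernoulli measure is the Markov measure whose transition matrix has all columns equal to [p];
     this matrix is positive, so the power 1 suffices. *)
  exists (\matrix_(i, j) p i), p, 1%N; split; first by move=> i j; rewrite mxE ltW.
  split; first by move=> j; rewrite -[RHS]p1; apply: eq_bigr => i _; rewrite mxE.
  split; first by move=> i j; rewrite /mxpow /= mulmx1 mxE.
  split; first by move=> i; exact: ltW.
  split => // m n w; rewrite hp big_ord_recl.
  by congr (_ * _)%:E; apply: eq_bigr => l _; rewrite mxE.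
(* The zeroth power is the identity, whose entry at a singular and a nonsingular letter vanishes. *)
have m0_gt0 : (0 < m0)%N.
  have [[s ss] [j nj]] := (sing_ne0, inv_ne0).
  case: m0 Pp => // /(_ s j); rewrite /mxpow /= mxE; case: eqP => [e|_].
    by rewrite e in ss; rewrite ss in nj.
  by rewrite mulr0n ltxx.
move=> e e0; apply: covers_sub (nonresonant_ae sing e0) => // x [xM nQ].
split=> // NR; apply: nQ; have [_ xi] := xM.
apply: (lyapunov_deviation P0 P1 m0_gt0 Pp q0 q1 hc (param_sing x) sing_ne0 _ NR).
by move=> j /xi /lt0r_neq0.
Qed.
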